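(* Let $W$ be one of the Weyl groups $W_{A_{n-1}}$, $W_{D_n}$ or $W_{B_n}$. The even center $\mathcal Z(\mathbb H^{-c}_W)$ of $\mathbb H^{-c}_W$ contains $\mathbb C[\eta_1^2,\dots,\eta_n^2]^W$ and $\mathbb C[x_1^2,\dots,x_n^2]^W$. In particular, $\mathbb H^{-c}_W$ is module-finite over its even center.
   Context: All algebras are over $\mathbb C$. The even center $\mathcal Z(A)$ of a superalgebra ($\mathbb Z_2$-graded algebra) $A$ is the set of even elements of $A$ that are central in $A$. Superscript $W$ denotes $W$-invariants; on $\mathbb C[x_1^2,\dots,x_n^2]$ and $\mathbb C[\eta_1^2,\dots,\eta_n^2]$ (commutative polynomial algebras) $W$ acts by permuting the indices through $W\to S_n$. Weyl groups: $W_{A_{n-1}}=S_n$, $W_{B_n}$ is the group of signed permutations of $1,\dots,n$, $W_{D_n}$ the subgroup of even signed permutations. $s_{ij}$ is the transposition of $i,j$; $\overline s_{ij}$ is the transposition of $i,j$ coupled with sign changes at $i,j$; $\tau_i$ is the sign change at $i$. Simple reflections: $s_i=s_{i,i+1}$ ($1\le i\le n-1$), and $s_n=\tau_n$ in type $B_n$, $s_n=\overline s_{n-1,n}$ in type $D_n$. $W$ acts on the span of symbols $a_1,\dots,a_n$ ($a=x,c$) by signed permutation of indices, $a_i\mapsto a_i^\sigma$: $s_{ij}$ swaps $a_i,a_j$; $\overline s_{ij}$ sends $a_i\mapsto-a_j$, $a_j\mapsto-a_i$; $\tau_i$ sends $a_i\mapsto-a_i$. $W\to S_n$, $\sigma\mapsto\sigma^*$,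 is the homomorphism forgetting signs ($s_{ij}^*=\overline s_{ij}^*=s_{ij}$, $\tau_i^*=1$). $\mathcal C_{\mathfrak h^*}$: Clifford algebra on pairwise anticommuting $c_1,\dots,c_n$ of square $1$. Spin Weyl group algebra $\mathbb C W^-$: generated by $t_i$ (one for each simple reflection) with $(t_it_j)^{m_{ij}}=(-1)^{m_{ij}+1}$, where $m_{ij}$ is the order of $s_is_j$. Set $t_{i\uparrow j}=t_it_{i+1}\cdots t_j$ if $i\le j$ and $1$ otherwise; $t_{i\downarrow j}=t_it_{i-1}\cdots t_j$ if $i\ge j$ and $1$ otherwise. For $1\le i<j\le n$ put $[i,j]=(-1)^{j-i-1}t_{j-1}\cdots t_{i+1}t_it_{i+1}\cdots t_{j-1}$, $[j,i]=-[i,j]$; $\overline{[i,j]}=\overline{[j,i]}=(-1)^{j-i-1}t_{j\uparrow n-1}t_{i\uparrow n-2}\,t_n\,t_{n-2\downarrow i}t_{n-1\downarrow j}$ in type $D_n$, and $=(-1)^{j-i}t_{j\uparrow n-1}t_{i\uparrow n-2}\,t_nt_{n-1}t_n\,t_{n-2\downarrow i}t_{n-1\downarrow j}$ in type $B_n$; $\overline{[i]}=(-1)^{n-i}t_i\cdots t_{n-1}t_nt_{n-1}\cdots t_i$ in type $B_n$. Let $t,u,v\in\mathbb C$. The algebra $\mathbb H^{-c}_W$ is generated by $x_i,\eta_i$ ($1\le i\le n$), $\mathcal C_{\mathfrak h^*}$ and $\mathbb C W^-$ subject to: $t_ic_j=-c_j^{s_i}t_i$; $\eta_i\eta_j=-\eta_j\eta_i$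 and $x_ix_j=x_jx_i$ ($i\ne j$); $c_i\eta_j=-\eta_jc_i$, $c_ix_j=(-1)^{\delta_{ij}}x_jc_i$ (all $i,j$); $t_ix_j=x_j^{s_i}t_i$, $t_i\eta_j=-\eta_j^{s_i^*}t_i$ (where $S_n$ permutes the indices of the $\eta_j$); and, with $i\ne j$ and $[\eta_i,x_j]$ denoting the commutator $\eta_ix_j-x_j\eta_i$: Type $A_{n-1}$: $[\eta_i,x_j]=u(1+c_ic_j)[i,j]$, $\ [\eta_i,x_i]=tc_i+u\sum_{k\ne i}(1+c_kc_i)[k,i]$. Types $D_n$, $B_n$: $[\eta_i,x_j]=u\big((1+c_ic_j)[i,j]-(1-c_ic_j)\overline{[i,j]}\big)$, $\ [\eta_i,x_i]=tc_i+u\sum_{k\neq i}\big((1+c_kc_i)[k,i]-(1-c_kc_i)\overline{[k,i]}\big)+v\overline{[i]}$, where the term $v\overline{[i]}$ is present only in type $B_n$. It is a superalgebra with $\eta_i,c_i,t_i$ odd and $x_i$ even. *)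

(* Defs.v *)
From HB Require Import structures.
From mathcomp Require Import all_boot all_order all_algebra all_fingroup.
From mathcomp Require Import boolp reals complex.
From mathcomp Require Import -(notations) monalg.
From mathcomp Require Export mpoly.

Set Implicit Arguments.
Unset Strict Implicit.
Unset Printing Implicit Defensive.

Import GRing.Theory.
Local Open Scope ring_scope.
Local Open Scope quotient_scope.

(* Finitely supported functions on words, with the concatenation product. *)
Notation free_alg F G := (malg (fmonom G) F).

Definition free_gen (F : fieldType) (G : choiceType) (g : G) : free_alg F G :=
  mkmalgU (fmu g) 1.

Lemma free_scaleAr (F : fieldType) (G : choiceType) k (a b : free_alg F G) :
  k *: (a * b) = a * (k *: b).
Proof.
have malgCr c (g : free_alg F G) : g * mkmalgU mone c = c *: g.
  rewrite malgM_def malgZ_def fgmulgU /fgscale; apply: eq_bigr => w _.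
  by rewrite mulm1; congr mkmalgU; rewrite mulrC.
by rewrite -(malgCr k (a * b)) -(malgCr k b) mulrA.
Qed.

Section Presented.
Variables (F : fieldType) (G : choiceType).
Variable rel : free_alg F G -> free_alg F G -> Prop.

Inductive rel_ideal : free_alg F G -> Prop :=
| rel_ideal_rel a b : rel a b -> rel_ideal (a - b)
| rel_ideal0 : rel_ideal 0
| rel_idealB a b : rel_ideal a -> rel_ideal b -> rel_ideal (a - b)
| rel_idealM a b c : rel_ideal b -> rel_ideal (a * b * c).

Definition rel_equiv (a b : free_alg F G) : bool := `[< rel_ideal (a - b) >].

Let idealN a : rel_ideal a -> rel_ideal (- a).
Proof. by move=> ia; rewrite -sub0r; apply: rel_idealB => //; exact: rel_ideal0. Qed.

Let idealD a b : rel_ideal a -> rel_ideal b -> rel_ideal (a + b).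
Proof. by move=> ia ib; rewrite -[b]opprK; apply/rel_idealB/idealN. Qed.

Let idealMl a b : rel_ideal b -> rel_ideal (a * b).
Proof. by move=> ib; rewrite -[_ * b]mulr1; apply: rel_idealM. Qed.

Let idealMr a b : rel_ideal a -> rel_ideal (a * b).
Proof. by move=> ia; rewrite -[a]mul1r; apply: rel_idealM. Qed.

Let idealZ k a : rel_ideal a -> rel_ideal (k *: a).
Proof. by move=> ia; rewrite -[a]mul1r scalerAl; apply: idealMl. Qed.

Lemma rel_equivP : equiv_class_of rel_equiv.
Proof.
split=> [a|a b|b a c].
- by apply/asboolP; rewrite subrr; constructor.
- by apply/asboolP/asboolP => /idealN; rewrite opprB.
- move=> /asboolP ab /asboolP bc; apply/asboolP.
  by have := idealD ab bc; rewrite addrA subrK.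
Qed.

Canonical rel_equiv_equiv := EquivRelPack rel_equivP.
Canonical rel_equiv_encModRel := defaultEncModRel rel_equiv.

Definition presented_alg : Type := {eq_quot rel_equiv}.

HB.instance Definition _ := Choice.on presented_alg.


Definition pres_pi (a : free_alg F G) : presented_alg :=
  \pi_{eq_quot rel_equiv} a.

Definition pres_repr (x : presented_alg) : free_alg F G :=
  generic_quotient.repr (x : {eq_quot rel_equiv}).

Lemma pres_piP a b : pres_pi a = pres_pi b <-> rel_ideal (a - b).
Proof. by split=> [/eqmodP/asboolP|h] //; apply/eqmodP/asboolP. Qed.

Lemma pres_reprK (x : presented_alg) : pres_pi (pres_repr x) = x.
Proof. exact: reprK. Qed.

Lemma pres_repr_pi a : rel_ideal (pres_repr (pres_pi a) - a).
Proof. by apply/pres_piP; rewrite pres_reprK. Qed.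

Definition pres_add (x y : presented_alg) := pres_pi (pres_repr x + pres_repr y).
Definition pres_opp (x : presented_alg) := pres_pi (- pres_repr x).
Definition pres_mul (x y : presented_alg) := pres_pi (pres_repr x * pres_repr y).
Definition pres_scale (k : F) (x : presented_alg) := pres_pi (k *: pres_repr x).

Let piD a b : pres_add (pres_pi a) (pres_pi b) = pres_pi (a + b).
Proof.
apply/pres_piP; rewrite opprD addrACA.
exact: idealD (pres_repr_pi a) (pres_repr_pi b).
Qed.

Let piN a : pres_opp (pres_pi a) = pres_pi (- a).
Proof. by apply/pres_piP; rewrite -opprD; apply/idealN/pres_repr_pi. Qed.

Let piM a b : pres_mul (pres_pi a) (pres_pi b) = pres_pi (a * b).
Proof.
apply/pres_piP; set a' := pres_repr _; set b' := pres_repr _.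
have -> : a' * b' - a * b = (a' - a) * b' + a * (b' - b).
  by rewrite mulrBl mulrBr addrA subrK.
exact: idealD (idealMr _ (pres_repr_pi a)) (idealMl _ (pres_repr_pi b)).
Qed.

Let piZ k a : pres_scale k (pres_pi a) = pres_pi (k *: a).
Proof. by apply/pres_piP; rewrite -scalerBr; apply/idealZ/pres_repr_pi. Qed.

Let pres_ind (P : presented_alg -> Prop) :
  (forall a, P (pres_pi a)) -> forall x, P x.
Proof. by move=> h x; rewrite -(pres_reprK x). Qed.

Let pres_addA : associative pres_add.
Proof. by do 3![elim/pres_ind => ?]; rewrite !piD addrA. Qed.
Let pres_addC : commutative pres_add.
Proof. by do 2![elim/pres_ind => ?]; rewrite !piD addrC. Qed.
Let pres_add0 : left_id (pres_pi 0) pres_add.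
Proof. by elim/pres_ind => ?; rewrite piD add0r. Qed.
Let pres_addN : left_inverse (pres_pi 0) pres_opp pres_add.
Proof. by elim/pres_ind => ?; rewrite piN piD addNr. Qed.

HB.instance Definition _ := GRing.isZmodule.Build presented_alg
  pres_addA pres_addC pres_add0 pres_addN.

Let pres_mulA : associative pres_mul.
Proof. by do 3![elim/pres_ind => ?]; rewrite !piM mulrA. Qed.
Let pres_mul1l : left_id (pres_pi 1) pres_mul.
Proof. by elim/pres_ind => ?; rewrite piM mul1r. Qed.
Let pres_mul1r : right_id (pres_pi 1) pres_mul.
Proof. by elim/pres_ind => ?; rewrite piM mulr1. Qed.
Let pres_mulDl : left_distributive pres_mul +%R.
Proof.
by do 3![elim/pres_ind => ?]; rewrite /GRing.add /= !(piM, piD) mulrDl.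
Qed.
Let pres_mulDr : right_distributive pres_mul +%R.
Proof.
by do 3![elim/pres_ind => ?]; rewrite /GRing.add /= !(piM, piD) mulrDr.
Qed.

(* Only a [pzRingType]: a presented algebra may be zero, and even when it is
   not, 1 != 0 needs a proof. *)
HB.instance Definition _ := GRing.Zmodule_isPzRing.Build presented_alg
  pres_mulA pres_mul1l pres_mul1r pres_mulDl pres_mulDr.

Let pres_scaleA k l x :
  pres_scale k (pres_scale l x) = pres_scale (k * l) x.
Proof. by elim/pres_ind: x => ?; rewrite !piZ scalerA. Qed.
Let pres_scale1 : left_id 1 pres_scale.
Proof. by elim/pres_ind => ?; rewrite piZ scale1r. Qed.
Let pres_scaleDr : right_distributive pres_scale +%R.
Proof.
by move=> k; do 2![elim/pres_ind => ?]; rewrite /GRing.add /= !(piZ, piD) scalerDr.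
Qed.
Let pres_scaleDl x : {morph pres_scale^~ x : k l / k + l}.
Proof.
move=> k l; elim/pres_ind: x => ?.
by rewrite [RHS]/GRing.add /= !piZ piD scalerDl.
Qed.

HB.instance Definition _ := GRing.Zmodule_isLmodule.Build F presented_alg
  pres_scaleA pres_scale1 pres_scaleDr pres_scaleDl.

Lemma pres_piD : {morph pres_pi : a b / a + b}.
Proof. by move=> a b; exact: esym (piD a b). Qed.
Lemma pres_piM : {morph pres_pi : a b / a * b}.
Proof. by move=> a b; exact: esym (piM a b). Qed.
Lemma pres_piZ k : {morph pres_pi : a / k *: a}.
Proof. by move=> a; exact: esym (piZ k a). Qed.
Lemma pres_scaleAl k (x y : presented_alg) : k *: (x * y) = (k *: x) * y.
Proof.
elim/pres_ind: x => a; elim/pres_ind: y => b.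
by rewrite -pres_piM -!pres_piZ -pres_piM scalerAl.
Qed.
Lemma pres_scaleAr k (x y : presented_alg) : k *: (x * y) = x * (k *: y).
Proof.
elim/pres_ind: x => a; elim/pres_ind: y => b.
by rewrite -pres_piM -!pres_piZ -pres_piM free_scaleAr.
Qed.
Lemma pres_pi1 : pres_pi 1 = 1.
Proof. by []. Qed.
Lemma pres_rel a b : rel a b -> pres_pi a = pres_pi b.
Proof. by move=> ab; apply/pres_piP; constructor. Qed.

End Presented.

Variant weyl_type := TypeA | TypeB | TypeD.

(* [TypeA] at [n] stands for A_(n-1). *)
Definition admissible (W : weyl_type) (n : nat) : bool :=
  if W is TypeD then (2 <= n)%N else (1 <= n)%N.

Definition weyl_rank (W : weyl_type) (n : nat) : nat :=
  if W is TypeA then n.-1 else n.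

Section Weyl.
Variable n : nat.

(* (i, false) stands for the symbol a_i and (i, true) for - a_i; a signed
   permutation is a permutation of the 2n symbols that commutes with the
   change of sign. *)
Definition sgn_perm := {perm 'I_n * bool}.

Definition is_signed (s : sgn_perm) : bool :=
  [forall p, s (p.1, ~~ p.2) == ((s p).1, ~~ (s p).2)].

Definition star (s : sgn_perm) (i : 'I_n) : 'I_n := (s (i, false)).1.
Definition flips (s : sgn_perm) (i : 'I_n) : bool := (s (i, false)).2.

Definition weyl (W : weyl_type) : {set sgn_perm} :=
  [set s | is_signed s &
     match W with
     | TypeA => [forall i, ~~ flips s i]
     | TypeB => true
     | TypeD => ~~ odd #|[set i | flips s i]|
     end].

Definition refl (i j : 'I_n) : sgn_perm :=
  (tperm (i, false) (j, false) * tperm (i, true) (j, true))%g.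
Definition refl_bar (i j : 'I_n) : sgn_perm :=
  (tperm (i, false) (j, true) * tperm (i, true) (j, false))%g.
Definition sign_change (i : 'I_n) : sgn_perm := tperm (i, false) (i, true).

Lemma weyl_rank_le (W : weyl_type) : (weyl_rank W n <= n)%N.
Proof. by case: W; rewrite //= leq_pred. Qed.

(* [k : 'I_(weyl_rank W n)] is the simple reflection numbered k + 1: the indices
   1, ..., n of the mathematics are the values 0, ..., n - 1 of ['I_n]. *)
Definition simple_refl (W : weyl_type) (k : 'I_(weyl_rank W n)) : sgn_perm :=
  let i := widen_ord (weyl_rank_le W) k in
  if (i.+1 < n)%N then refl i (insubd i i.+1)
  else if W is TypeD then refl_bar (insubd i i.-1) i
  else sign_change i.

Definition sgn_act (V : zmodType) (a : 'I_n -> V) (s : sgn_perm) (j : 'I_n) : V :=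
  if flips s j then - a (star s j) else a (star s j).

Definition weyl_invariant (F : fieldType) (W : weyl_type) (p : {mpoly F[n]}) :=
  forall s, s \in weyl W -> comp_mpoly [tuple 'X_(star s i) | i < n] p = p.

End Weyl.

Section OddHeckeClifford.
Variables (F : fieldType) (W : weyl_type) (n : nat) (t u v : F).

Inductive hgen :=
| GenX of 'I_n | GenEta of 'I_n | GenC of 'I_n | GenT of 'I_(weyl_rank W n).

Definition hgen_enc (g : hgen) : 'I_n + 'I_n + ('I_n + 'I_(weyl_rank W n)) :=
  match g with
  | GenX i => inl (inl i) | GenEta i => inl (inr i)
  | GenC i => inr (inl i) | GenT i => inr (inr i)
  end.
Definition hgen_dec (s : 'I_n + 'I_n + ('I_n + 'I_(weyl_rank W n))) : hgen :=
  match s with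
  | inl (inl i) => GenX i | inl (inr i) => GenEta i
  | inr (inl i) => GenC i | inr (inr i) => GenT i
  end.
Lemma hgen_encK : cancel hgen_enc hgen_dec. Proof. by case. Qed.
HB.instance Definition _ := Choice.copy hgen (can_type hgen_encK).

Definition odd_gen (g : hgen) : bool := if g is GenX _ then false else true.

Local Notation A := (free_alg F hgen).

Local Notation x i := (free_gen F (GenX i)).
Local Notation eta i := (free_gen F (GenEta i)).
Local Notation c i := (free_gen F (GenC i)).
Local Notation tt k := (free_gen F (GenT k)).

(* The words in the t_k below are written with the indices 1, ..., n; the value
   of [tgen] outside 1, ..., rank is irrelevant, as no such index occurs. *)
Definition tgen (k : nat) : A :=
  if k is k'.+1 then oapp (fun l : 'I_(weyl_rank W n) => tt l) 0 (insub k')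
  else 0.
Definition tword (w : seq nat) : A := \prod_(k <- w) tgen k.

(* [up i j] is i, i + 1, ..., j and [down i j] is i, i - 1, ..., j; they are
   empty if i > j, resp. i < j. *)
Definition up (i j : nat) : seq nat := iota i (j.+1 - i).
Definition down (i j : nat) : seq nat := rev (up j i).

(* [brk i j], [brk_bar i j] and [brk_sgl i] are the odd reflections [i,j],
   \overline{[i,j]} and \overline{[i]}; the [_lt] versions take indices
   1 <= i < j <= n. *)
Definition brk_lt (i j : nat) : A :=
  (-1) ^+ (j - i - 1) * tword (down (j - 1) i ++ up (i + 1) (j - 1)).

Definition brk_bar_lt (i j : nat) : A :=
  let l := up j (n - 1) ++ up i (n - 2) in
  let r := down (n - 2) i ++ down (n - 1) j in
  match W with
  | TypeA => 0
  | TypeD => (-1) ^+ (j - i - 1) * tword (l ++ [:: n] ++ r)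
  | TypeB => (-1) ^+ (j - i) * tword (l ++ [:: n; (n - 1)%N; n] ++ r)
  end.

Definition brk (i j : 'I_n) : A :=
  if (i < j)%N then brk_lt i.+1 j.+1 else - brk_lt j.+1 i.+1.

Definition brk_bar (i j : 'I_n) : A :=
  if (i < j)%N then brk_bar_lt i.+1 j.+1 else brk_bar_lt j.+1 i.+1.

Definition brk_sgl (i : 'I_n) : A :=
  let k := i.+1 in
  (-1) ^+ (n - k) * tword (up k (n - 1) ++ [:: n] ++ down (n - 1) k).

Definition cross (i j : 'I_n) : A :=
  match W with
  | TypeA => (1 + c i * c j) * brk i j
  | _ => (1 + c i * c j) * brk i j - (1 - c i * c j) * brk_bar i j
  end.

Definition comm (a b : A) : A := a * b - b * a.

(* Each constructor [hrel a b] is a defining relation a = b. *)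
Inductive hrel : A -> A -> Prop :=
| Rel_cc i : hrel (c i * c i) 1
| Rel_cicj i j : i != j -> hrel (c i * c j) (- (c j * c i))
| Rel_t (k l : 'I_(weyl_rank W n)) :
    let m := #[simple_refl k * simple_refl l]%g in
    hrel ((tt k * tt l) ^+ m) ((-1) ^+ m.+1)
| Rel_tc k j :
    hrel (tt k * c j) (- (sgn_act (fun i => c i) (simple_refl k) j * tt k))
| Rel_etaeta i j : i != j -> hrel (eta i * eta j) (- (eta j * eta i))
| Rel_xx i j : i != j -> hrel (x i * x j) (x j * x i)
| Rel_ceta i j : hrel (c i * eta j) (- (eta j * c i))
| Rel_cx i j : hrel (c i * x j) ((-1) ^+ (i == j) * (x j * c i))
| Rel_tx k j :
    hrel (tt k * x j) (sgn_act (fun i => x i) (simple_refl k) j * tt k)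
| Rel_teta k j :
    hrel (tt k * eta j) (- (eta (star (simple_refl k) j) * tt k))
| Rel_etax_ne i j : i != j -> hrel (comm (eta i) (x j)) (u *: cross i j)
| Rel_etax i :
    hrel (comm (eta i) (x i))
      (t *: c i + u *: (\sum_(k | k != i) cross k i)
       + (if W is TypeB then v *: brk_sgl i else 0)).

Definition Hmc := presented_alg hrel.
HB.instance Definition _ := GRing.PzRing.on Hmc.
HB.instance Definition _ := GRing.Lmodule.on Hmc.

Definition Hx (i : 'I_n) : Hmc := pres_pi hrel (x i).
Definition Heta (i : 'I_n) : Hmc := pres_pi hrel (eta i).

(* The even part of H is spanned by the words with an even number of odd
   generators. *)
Definition even_word (w : seq hgen) : bool := ~~ odd (count odd_gen w).

Definition Heven (h : Hmc) : Prop :=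
  exists2 a : A, (forall w : fmonom hgen, monalg.mcoeff w a != 0 -> even_word w)
               & pres_pi hrel a = h.

Definition even_center (z : Hmc) : Prop :=
  Heven z /\ forall h : Hmc, z * h = h * z.

Definition module_finite_over_even_center : Prop :=
  exists gs : seq Hmc, forall h : Hmc,
    exists2 z : 'I_(size gs) -> Hmc,
      (forall k, even_center (z k)) & h = \sum_k z k * gs`_k.

(* The value of p at pairwise commuting elements a_1, ..., a_n of H;
   [mmap] would need H to be an [nzRingType]. *)
Definition Heval (a : 'I_n -> Hmc) (p : {mpoly F[n]}) : Hmc :=
  \sum_(m <- msupp p) p@_m *: \prod_i a i ^+ m i.

End OddHeckeClifford.

(* Main.v *)
Require Import Defs.
From HB Require Import structures.
From mathcomp Require Import all_boot all_order all_algebra all_fingroup.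
From mathcomp Require Import cyclic zify ssrcomplements.
From mathcomp Require Import -(notations) monalg.
From mathcomp Require Import reals complex mpoly.
From Corelib Require Import Setoid Morphisms.

Set Implicit Arguments.
Unset Strict Implicit.
Unset Printing Implicit Defensive.

Import GRing.Theory.

(** Why the theorem holds.

    Put [y_j = x_j ^ 2].  The [y_j] commute with every [x_k] and [c_k], and a
    generator [t_k] permutes them through [W -> S_n]; so a symmetric polynomial
    [f(y)] can only fail to be central because of the [eta_i].  Now
    [D = [eta_i, .]] is a derivation.  For [j <> i] the element [E_j = D(y_j)]
    satisfies [E_j * y_k = y_(i j)k * E_j], because both odd reflections attached
    to [i, j] permute the squares by the transposition [(i j)], and the relations
    give [D(y_i) = - sum_j E_j].  A derivation with these values is
    [D(f(y)) = sum_j (f - (i j) f) / (y_j - y_i) * E_j], a combination of divided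
    differences, which vanishes when [f] is symmetric ([ev_derivation],
    [ev_sym_comm]).  The argument for [eta_j ^ 2] against the [x_i] is the same
    ([eta_x2_diag], [x_eta2_diag] and their companions check the hypotheses).

    For finiteness, moving each generator to its place shows that products
    [X * E * C * T] of words in the [x], the [eta], the [c] and the [t] span the
    algebra: the commutator of an [eta] with an [x] is a combination of words in
    the [c] and the [t], so it lowers the number of [eta]'s
    ([normal_span]).  Each of the four kinds of words is finite over the even
    center.  The element [x_i ^ 2] is a root of the product of the [X - y_j],
    whose coefficients are symmetric in the [y_j], hence even and central; the
    same holds for [eta_i ^ 2], and [c_i ^ 2 = 1].  Finally, up to sign there are
    finitely many words in the [t_k]; this is the finiteness of the Coxeter group
    with the given presentation, obtained by adjoining one letter at a time to
    the words in the previous letters ([adjoin_chain_finite]).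

    The identities are proved in an arbitrary ring in which the relations hold;
    the presented algebra enters in the last part. *)

(** * Signed permutations and orders of products of reflections *)

Section Order.
Local Open Scope group_scope.
Variable gT : finGroupType.
Implicit Types s r : gT.

Lemma mul_inv_neq1 s r : s * s = 1 -> s != r -> s * r != 1.
Proof.
move=> ss; apply: contra_neq => sr1.
by apply: (mulgI s); rewrite sr1 ss.
Qed.

(** The defining relations of the [t_k] involve the exact orders of the products of
    two simple reflections; each is read off from a relation between the two. *)
Lemma order_commuting s r : s * s = 1 -> r * r = 1 -> s != r -> s * r = r * s ->
  #[s * r] = 2.
Proof.
move=> ss rr sr c; apply/prime.prime_nt_dvdP => //; first by rewrite order_eq1 mul_inv_neq1.
by rewrite order_dvdn expgS expg1 {2}c mulgA -(mulgA s) rr mulg1 ss.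
Qed.

Lemma order_braid s r : s * s = 1 -> r * r = 1 -> s != r -> s * r * s = r * s * r ->
  #[s * r] = 3.
Proof.
move=> ss rr sr c; apply/prime.prime_nt_dvdP => //; first by rewrite order_eq1 mul_inv_neq1.
rewrite order_dvdn !expgS expg0 mulg1 !mulgA c.
by rewrite -(mulgA _ r r) rr mulg1 -(mulgA _ s s) ss mulg1 rr.
Qed.

Lemma order_braid4 s r : s * s = 1 -> r * r = 1 -> s * r * s * r != 1 ->
  s * r * s * r = r * s * r * s -> #[s * r] = 4.
Proof.
move=> ss rr s4 c.
have d4 : #[s * r] %| 2 ^ 2.
  rewrite order_dvdn !expgS expg0 mulg1 !mulgA c.
  rewrite -(mulgA _ s s) ss mulg1 -(mulgA _ r r) rr mulg1.
  by rewrite -(mulgA _ s s) ss mulg1 rr.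
have /(dvdn_pfactor _ _ (isT : prime 2))[[|[|[|m]]] m2 e] := d4; rewrite // e.
  by move/eqP: e s4; rewrite order_eq1 => /eqP e; rewrite -mulgA e mulg1 eqxx.
by move: s4; rewrite -mulgA -(expgS _ 1) -order_dvdn e.
Qed.

End Order.

Section SignedPerms.
Local Open Scope group_scope.
Variable n : nat.
Local Notation perms := (sgn_perm n).
Implicit Types (i j k a b : 'I_n) (e : bool) (s r : perms).

Lemma reflE i j k e : i != j -> refl i j (k, e) = (tperm i j k, e).
Proof.
move=> ij; have ji : j != i by rewrite eq_sym.
rewrite /refl permM !permE /= !xpair_eqE.
by case: e; case: (eqVneq k i) => [->|ki]; case: (eqVneq k j) => [jk|kj];
  rewrite ?eqxx ?(negPf ij) ?(negPf ji) ?(negPf ki) ?(negPf kj) ?andbF ?andbT //=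
    ?xpair_eqE ?eqxx ?(negPf ij) ?(negPf ji) ?(negPf ki) ?(negPf kj) ?andbF ?andbT ?jk ?eqxx.
Qed.

Lemma refl_barE i j k e : i != j ->
  refl_bar i j (k, e) = (tperm i j k, e (+) ((k == i) || (k == j))).
Proof.
move=> ij; have ji : j != i by rewrite eq_sym.
rewrite /refl_bar permM !permE /= !xpair_eqE.
by case: e; case: (eqVneq k i) => [->|ki]; case: (eqVneq k j) => [jk|kj];
  rewrite ?eqxx ?(negPf ij) ?(negPf ji) ?(negPf ki) ?(negPf kj) ?andbF ?andbT //=
    ?xpair_eqE ?eqxx ?(negPf ij) ?(negPf ji) ?(negPf ki) ?(negPf kj) ?andbF ?andbT ?jk ?eqxx.
Qed.

Lemma sign_changeE i k e : sign_change i (k, e) = (k, e (+) (k == i)).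
Proof.
rewrite /sign_change permE /= !xpair_eqE.
by case: e; case: (eqVneq k i) => [->|ki]; rewrite ?andbF ?andbT.
Qed.

Definition signed s := forall p, s (p.1, ~~ p.2) = ((s p).1, ~~ (s p).2).

Lemma signed1 : signed 1.
Proof. by move=> p; rewrite !perm1. Qed.

Lemma signed_refl i j : i != j -> signed (refl i j).
Proof. by move=> ij [k e]; rewrite !reflE. Qed.
Lemma signed_refl_bar i j : i != j -> signed (refl_bar i j).
Proof. by move=> ij [k e]; rewrite !refl_barE // addNb. Qed.
Lemma signed_sign_change i : signed (sign_change i).
Proof. by move=> [k e]; rewrite !sign_changeE addNb. Qed.

Lemma refl_sq i j : i != j -> refl i j * refl i j = 1.
Proof. by move=> ij; apply/permP => -[k e]; rewrite permM !reflE // tpermK perm1. Qed.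

Lemma refl_bar_sq i j : i != j -> refl_bar i j * refl_bar i j = 1.
Proof.
move=> ij; apply/permP => -[k e]; rewrite permM !refl_barE // tpermK perm1.
congr (_, _); rewrite -addbA; case: tpermP => [->|->|/eqP/negPf-> /eqP/negPf->].
- by rewrite !eqxx orbT addbb addbF.
- by rewrite !eqxx orbT addbb addbF.
by rewrite addbF.
Qed.

Lemma sign_change_sq i : sign_change i * sign_change i = 1.
Proof. exact: tperm2. Qed.

(** The reflections are products of transpositions of symbols, so conjugation
    relabels them; commutation and braid relations become equalities of
    conjugates. *)
Lemma reflJ i j i' j' s :
  (forall e, s (i, e) = (i', e)) -> (forall e, s (j, e) = (j', e)) ->
  refl i j ^ s = refl i' j'.
Proof. by move=> si sj; rewrite /refl conjMg !tpermJ !si !sj. Qed.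

Lemma refl_barJ i j i' j' s :
  (forall e, s (i, e) = (i', e)) -> (forall e, s (j, e) = (j', e)) ->
  refl_bar i j ^ s = refl_bar i' j'.
Proof. by move=> si sj; rewrite /refl_bar conjMg !tpermJ !si !sj. Qed.

(** A conjugation that changes the sign of one of the two indices. *)
Lemma refl_flipJ i j i' j' s :
  (forall e, s (i, e) = (i', e)) -> (forall e, s (j, e) = (j', ~~ e)) ->
  refl i j ^ s = refl_bar i' j'.
Proof. by move=> si sj; rewrite /refl /refl_bar conjMg !tpermJ !si !sj. Qed.

Lemma sign_changeJ i i' s : (forall e, s (i, e) = (i', e)) ->
  sign_change i ^ s = sign_change i'.
Proof. by move=> si; rewrite /sign_change tpermJ !si. Qed.

Lemma conj_sq s r : r * r = 1 -> s ^ r = r * s * r.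
Proof. by move=> rr; rewrite conjgE (eqP (_ : r^-1 == r)) ?mulgA // eq_invg_mul rr. Qed.

Lemma braid_conj s r : s * s = 1 -> r * r = 1 -> r ^ s = s ^ r -> s * r * s = r * s * r.
Proof. by move=> ss rr; rewrite !conj_sq. Qed.

Lemma commute_conj s r : r * r = 1 -> s ^ r = s -> s * r = r * s.
Proof. by move=> rr e; rewrite -{1}e conj_sq // -!mulgA rr mulg1. Qed.

Lemma order_refl_refl a b c : a != b -> b != c -> a != c ->
  #[refl a b * refl b c] = 3.
Proof.
move=> ab bc ac; have ba : b != a by rewrite eq_sym.
have cb : c != b by rewrite eq_sym. have ca : c != a by rewrite eq_sym.
apply: order_braid; rewrite ?refl_sq //.
  apply: contraTneq isT => /permP/(_ (a, false)); rewrite !reflE //.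
  by rewrite tpermL tpermD // => -[/eqP]; rewrite eq_sym (negPf ab).
apply: braid_conj; rewrite ?refl_sq //.
rewrite (@reflJ b c a c) => [|e|e]; first last.
- by rewrite reflE // tpermD.
- by rewrite reflE // tpermR.
rewrite (@reflJ a b a c) // => e; first by rewrite reflE // tpermD.
by rewrite reflE // tpermL.
Qed.

Lemma order_refl_refl_bar a b c : a != b -> b != c -> a != c ->
  #[refl a b * refl_bar b c] = 3.
Proof.
move=> ab bc ac; have ba : b != a by rewrite eq_sym.
have cb : c != b by rewrite eq_sym. have ca : c != a by rewrite eq_sym.
apply: order_braid; rewrite ?refl_sq ?refl_bar_sq //.
  apply: contraTneq isT => /permP/(_ (a, false)); rewrite !reflE // refl_barE //.
  by rewrite tpermL tpermD // => -[/eqP]; rewrite eq_sym (negPf ab).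
apply: braid_conj; rewrite ?refl_sq ?refl_bar_sq //.
rewrite (@refl_barJ b c a c) => [|e|e]; first last.
- by rewrite reflE // tpermD.
- by rewrite reflE // tpermR.
rewrite (@refl_flipJ a b a c) // => e.
  by rewrite refl_barE // tpermD // (negPf ab) (negPf ac) addbF.
by rewrite refl_barE // tpermL eqxx addbT.
Qed.

Lemma order_refl_far a b c d : a != b -> c != d -> a != c -> a != d -> b != c -> b != d ->
  #[refl a b * refl c d] = 2.
Proof.
move=> ab cd ac ad bc bd.
have [ca da cb db] : [/\ c != a, d != a, c != b & d != b] by split; rewrite eq_sym.
apply: order_commuting; rewrite ?refl_sq //.
  apply: contraTneq isT => /permP/(_ (a, false)); rewrite !reflE //.
  by rewrite tpermL tpermD // => -[/eqP]; rewrite eq_sym (negPf ab).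
by apply: commute_conj; rewrite ?refl_sq //; apply: reflJ => e; rewrite reflE // tpermD.
Qed.

Lemma order_refl_bar_far a b c d : a != b -> c != d -> a != c -> a != d -> b != c -> b != d ->
  #[refl a b * refl_bar c d] = 2.
Proof.
move=> ab cd ac ad bc bd.
have [ca da cb db] : [/\ c != a, d != a, c != b & d != b] by split; rewrite eq_sym.
apply: order_commuting; rewrite ?refl_sq ?refl_bar_sq //.
  apply: contraTneq isT => /permP/(_ (a, false)); rewrite !reflE // refl_barE //.
  by rewrite tpermL tpermD // => -[/eqP]; rewrite eq_sym (negPf ab).
apply: commute_conj; rewrite ?refl_bar_sq //; apply: reflJ => e; rewrite refl_barE // tpermD //.
  by rewrite (negPf ac) (negPf ad) addbF.
by rewrite (negPf bc) (negPf bd) addbF.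
Qed.

Lemma order_refl_bar_same a b : a != b -> #[refl a b * refl_bar a b] = 2.
Proof.
move=> ab; apply: order_commuting; rewrite ?refl_sq ?refl_bar_sq //.
  apply: contraTneq isT => /permP/(_ (a, false)); rewrite reflE // refl_barE //.
  by rewrite eqxx.
apply/permP => -[k e]; rewrite permM [RHS]permM reflE // !refl_barE // reflE //.
congr (_, _ (+) _); case: tpermP => [->|->|] //; by rewrite !eqxx orbT.
Qed.

Lemma order_refl_sign_far a b c : a != b -> a != c -> b != c ->
  #[refl a b * sign_change c] = 2.
Proof.
move=> ab ac bc.
apply: order_commuting; rewrite ?refl_sq ?sign_change_sq //.
  apply: contraTneq isT => /permP/(_ (a, false)); rewrite !reflE // sign_changeE //.
  by rewrite tpermL => -[/eqP]; rewrite eq_sym (negPf ab).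
apply: commute_conj; rewrite ?sign_change_sq //; apply: reflJ => e; rewrite sign_changeE.
  by rewrite (negPf ac) addbF.
by rewrite (negPf bc) addbF.
Qed.

Lemma order_refl_sign a b : a != b -> #[refl a b * sign_change b] = 4.
Proof.
move=> ab; have ba : b != a by rewrite eq_sym.
have sJ : refl a b * sign_change b * refl a b = sign_change a.
  by rewrite -conj_sq ?refl_sq //; apply: sign_changeJ => e; rewrite reflE // tpermR.
apply: order_braid4; rewrite ?refl_sq ?sign_change_sq //; rewrite sJ.
  apply: contraTneq isT => /permP/(_ (a, false)).
  by rewrite permM !sign_changeE perm1 eqxx (negPf ab).
rewrite -2!mulgA [refl a b * _]mulgA sJ.
apply/permP => -[k e]; rewrite !permM !sign_changeE.
by rewrite -!addbA [(k == a) (+) _]addbC.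
Qed.

End SignedPerms.

(** * Permutations attached to words in the simple reflections *)

Section WordPerm.
Local Open Scope group_scope.
Variables (W : weyl_type) (n : nat).
Implicit Types (i j a b : 'I_n) (e : bool) (w : seq nat).

(** Letters are numbered from 1, as in [tgen]; a number that is not a letter acts
    trivially, which is harmless because [tgen] vanishes there. *)
Definition letter_perm (k : nat) : sgn_perm n :=
  if k is k'.+1 then oapp (@simple_refl n W) 1 (insub k') else 1.

Arguments letter_perm : simpl never.

(** Letters of a word act from right to left, whereas the product of permutations
    composes from left to right. *)
Definition word_perm w : sgn_perm n := foldr (fun k g => g * letter_perm k) 1 w.

Lemma letter_permE (o : 'I_(weyl_rank W n)) : letter_perm o.+1 = simple_refl o.
Proof. by rewrite /letter_perm valK. Qed.

Lemma rank_lt k : (k.+1 < n)%N -> (k < weyl_rank W n)%N.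
Proof. by case: W => /=; lia. Qed.

Lemma insubd_ord i k : (k < n)%N -> val (insubd i k) = k.
Proof. by move=> kn; rewrite val_insubd kn. Qed.

Lemma letter_refl a b : b = a.+1 :> nat -> letter_perm b = refl a b.
Proof.
move=> ba; have an : (a.+1 < n)%N by rewrite -ba.
rewrite ba (letter_permE (Ordinal (rank_lt an))) /simple_refl /= an.
by congr refl; apply: val_inj; rewrite //= insubd_ord.
Qed.

Lemma letter_last a : W = TypeB -> a.+1 = n :> nat -> letter_perm n = sign_change a.
Proof.
move=> WB an; have ar : (a < weyl_rank W n)%N by rewrite WB.
have -> : letter_perm n = simple_refl (Ordinal ar) by rewrite -letter_permE -[RHS]/(letter_perm a.+1) an.
rewrite /simple_refl; set o := widen_ord _ _; have -> : o = a by apply: val_inj.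
by rewrite an ltnn WB.
Qed.

Lemma letter_last_bar a b : W = TypeD -> b = a.+1 :> nat -> b.+1 = n :> nat ->
  letter_perm n = refl_bar a b.
Proof.
move=> WD ba bn; have br : (b < weyl_rank W n)%N by rewrite WD.
have -> : letter_perm n = simple_refl (Ordinal br) by rewrite -letter_permE -[RHS]/(letter_perm b.+1) bn.
rewrite /simple_refl; set o := widen_ord _ _; have -> : o = b by apply: val_inj.
rewrite bn ltnn WD; congr refl_bar.
have b1 : (b.-1 < n)%N by rewrite ba /= ltn_ord.
by apply: val_inj; rewrite /= insubd_ord // ba.
Qed.

Hypothesis hn : admissible W n.

Lemma simple_refl_cases (o : 'I_(weyl_rank W n)) :
  [\/ exists a b, [/\ b = a.+1 :> nat, b = o.+1 :> nat & simple_refl o = refl a b],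
      exists a, [/\ W = TypeB, a.+1 = n :> nat, o.+1 = n :> nat & simple_refl o = sign_change a]
    | exists a b, [/\ W = TypeD, b = a.+1 :> nat, b.+1 = n :> nat &
        o.+1 = n :> nat /\ simple_refl o = refl_bar a b]].
Proof.
have on : (o < n)%N := leq_trans (ltn_ord o) (weyl_rank_le n W).
have [o1|o1] := ltnP o.+1 n.
  constructor 1; exists (Ordinal on), (Ordinal o1).
  by rewrite -letter_permE; split=> //; exact: (@letter_refl (Ordinal on) (Ordinal o1)).
have {o1}o1 : o.+1 = n by lia.
have [WB|[WD|WA]] : W = TypeB \/ W = TypeD \/ W = TypeA by case: (W); auto.
- constructor 2; exists (Ordinal on); split=> //.
  by rewrite -letter_permE o1; apply: letter_last.
- constructor 3; have n2 : (1 < n)%N by move: hn; rewrite WD.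
  have o2 : (o.-1 < n)%N by lia.
  have e : o = o.-1.+1 :> nat by lia.
  exists (Ordinal o2), (Ordinal on); split=> //; split=> //.
  by rewrite -letter_permE o1; apply: letter_last_bar.
(* In type A the rank is [n.-1], so there is no last letter to consider. *)
have rE : weyl_rank W n = n.-1 by rewrite WA.
by have : (o < n.-1)%N by [rewrite -[X in (_ < X)%N]rE ltn_ord]; lia.
Qed.

Lemma succ_neq a b : b = a.+1 :> nat -> a != b.
Proof. by move=> ba; rewrite -(inj_eq val_inj) /= ba neq_ltn leqnn. Qed.

Lemma simple_refl_sq (o : 'I_(weyl_rank W n)) : simple_refl o * simple_refl o = 1.
Proof.
case: (simple_refl_cases o) => [[a [b [ba _ ->]]]|[a [_ _ _ ->]]|[a [b [_ ba _ [_ ->]]]]].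
- by rewrite refl_sq ?succ_neq.
- by rewrite sign_change_sq.
- by rewrite refl_bar_sq ?succ_neq.
Qed.

Lemma simple_refl_signed (o : 'I_(weyl_rank W n)) : signed (simple_refl o).
Proof.
case: (simple_refl_cases o) => [[a [b [ba _ ->]]]|[a [_ _ _ ->]]|[a [b [_ ba _ [_ ->]]]]].
- exact/signed_refl/succ_neq.
- exact: signed_sign_change.
- exact/signed_refl_bar/succ_neq.
Qed.

Lemma letter_sq k : letter_perm k * letter_perm k = 1.
Proof.
case: k => [|k]; rewrite /letter_perm ?mulg1 //; case: insub => [o|] /=; rewrite ?mulg1 //.
exact: simple_refl_sq.
Qed.

Lemma letter_signed k : signed (letter_perm k).
Proof.
case: k => [|k]; rewrite /letter_perm; first exact: signed1.
case: insub => [o|] /=; [exact: simple_refl_signed | exact: signed1].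
Qed.

Lemma word_perm_cat w1 w2 : word_perm (w1 ++ w2) = word_perm w2 * word_perm w1.
Proof. by elim: w1 => [|k w IH] /=; rewrite ?mulg1 // IH mulgA. Qed.

Lemma word_perm_rev w : word_perm (rev w) = (word_perm w)^-1.
Proof.
elim: w => [|k w IH] /=; first by rewrite invg1.
rewrite rev_cons -cats1 word_perm_cat IH /= mul1g invMg.
by congr (_ * _); apply/esym/eqP; rewrite eq_invg_mul letter_sq.
Qed.

(** The letters are involutions, so a palindrome acts as a conjugate of its middle. *)
Lemma word_perm_conj l m : word_perm (l ++ m ++ rev l) = word_perm m ^ word_perm l.
Proof. by rewrite !word_perm_cat word_perm_rev conjgE mulgA. Qed.

Lemma word_perm_fix w a e :
  all (fun k => [&& 0 < k, k < n, (a : nat) != k & a.+1 != k]%N) w -> word_perm w (a, e) = (a, e).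
Proof.
elim: w => [|k w IH] /=; first by rewrite perm1.
move=> /andP[/and4P[k0 kn ak ak1] /IH{}IH]; rewrite permM IH.
have k1 : (k.-1 < n)%N by lia.
rewrite (letter_refl (a := Ordinal k1) (b := Ordinal kn)) //=; last by lia.
rewrite reflE ?succ_neq //=; last by lia.
by rewrite tpermD // -(inj_eq val_inj) /=; lia.
Qed.

Lemma up_cons (i j : nat) : (i <= j)%N -> up i j = i :: up i.+1 j.
Proof. by move=> ij; rewrite /up subSn //= subSS. Qed.

Lemma up_nil (i j : nat) : (j < i)%N -> up i j = [::].
Proof. by move=> ij; rewrite /up; have -> : (j.+1 - i = 0)%N by lia. Qed.

Lemma all_up (P : pred nat) (i j : nat) : (forall k, (i <= k <= j)%N -> P k) -> all P (up i j).
Proof. by move=> h; apply/allP => k; rewrite mem_iota => kij; apply: h; lia. Qed.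

(** An increasing word is a cycle: it brings its right end down to its left end. *)
Lemma word_perm_up a b e : (a <= b)%N -> word_perm (up a.+1 b) (b, e) = (a, e).
Proof.
move=> ab; move: {-1}(b - a)%N (erefl (b - a)%N) => d.
elim: d a ab => [|d IH] a ab dE.
  have -> : a = b by apply: val_inj => /=; lia.
  by rewrite up_nil //= perm1.
have a1 : (a.+1 < n)%N by have := ltn_ord b; lia.
rewrite up_cons; last by lia.
rewrite /= permM (IH (Ordinal a1)) /=; try lia.
rewrite (letter_refl (b := Ordinal a1) (a := a)) //.
by rewrite reflE ?tpermR // succ_neq.
Qed.

Lemma word_perm_up_fix a k l e : (0 < k)%N -> (l < n)%N -> (a.+1 < k)%N || (l < a)%N ->
  word_perm (up k l) (a, e) = (a, e).
Proof. by move=> k0 ln al; apply/word_perm_fix/all_up => m; lia. Qed.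

Lemma down_rev (i j : nat) : down i j = rev (up j i). Proof. by []. Qed.

(** The words defining the odd reflections are palindromes around an odd middle.
    This gives at once the reflection through which they act (a conjugate of the
    middle) and the parity of their length. *)
Lemma brk_wordE i j : (i < j)%N ->
  down (j.+1 - 1) i.+1 ++ up (i.+1 + 1) (j.+1 - 1) =
  rev (up i.+2 j) ++ [:: i.+1] ++ rev (rev (up i.+2 j)).
Proof.
move=> ij; rewrite revK subn1 addn1 /= down_rev up_cons // rev_cons -cats1.
by rewrite -catA.
Qed.

Lemma brk_word_perm i j : (i < j)%N ->
  word_perm (down (j.+1 - 1) i.+1 ++ up (i.+1 + 1) (j.+1 - 1)) = refl i j.
Proof.
move=> ij; have i1 : (i.+1 < n)%N by have := ltn_ord j; lia.
rewrite brk_wordE // word_perm_conj /= mul1g (letter_refl (b := Ordinal i1) (a := i)) //.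
rewrite word_perm_rev; apply: reflJ => e; apply: (canLR (permK _)).
  by rewrite word_perm_up_fix //; lia.
by rewrite (@word_perm_up (Ordinal i1)).
Qed.

Lemma bar_wordE i j m :
  (up j.+1 (n - 1) ++ up i.+1 (n - 2)) ++ m ++ (down (n - 2) i.+1 ++ down (n - 1) j.+1) =
  (up j.+1 (n - 1) ++ up i.+1 (n - 2)) ++ m ++ rev (up j.+1 (n - 1) ++ up i.+1 (n - 2)).
Proof. by rewrite rev_cat. Qed.

Lemma bar_prefix_perm i j a b e : (i < j)%N -> b = a.+1 :> nat -> b.+1 = n :> nat ->
  word_perm (up j.+1 (n - 1) ++ up i.+1 (n - 2)) (a, e) = (i, e) /\
  word_perm (up j.+1 (n - 1) ++ up i.+1 (n - 2)) (b, e) = (j, e).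
Proof.
move=> ij ba bn; have := ltn_ord j => jn.
have -> : (n - 1)%N = b by lia. have -> : (n - 2)%N = a by lia.
rewrite word_perm_cat !permM word_perm_up; last by lia.
rewrite word_perm_up_fix //; last by lia.
rewrite [word_perm (up i.+1 a) _]word_perm_up_fix //; try lia.
by rewrite word_perm_up //; lia.
Qed.

(** In type D the middle letter is already a barred reflection; in type B the middle
    [n; n - 1; n] is the reflection in the indices [n - 1], [n] conjugated by the
    sign change of [n]. *)
Lemma bar_word_perm_D i j : W = TypeD -> (i < j)%N ->
  word_perm ((up j.+1 (n - 1) ++ up i.+1 (n - 2)) ++ [:: n] ++
             (down (n - 2) i.+1 ++ down (n - 1) j.+1)) = refl_bar i j.
Proof.
move=> WD ij; have := ltn_ord j => jn.
have an : (n - 2 < n)%N by lia. have bn : (n - 1 < n)%N by lia.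
have ba : Ordinal bn = (Ordinal an).+1 :> nat by rewrite /=; lia.
have b1 : (Ordinal bn).+1 = n by rewrite /=; lia.
rewrite bar_wordE word_perm_conj /= mul1g (letter_last_bar WD ba b1).
by apply: refl_barJ => e; have [] := bar_prefix_perm e ij ba b1.
Qed.

Lemma bar_word_perm_B i j : W = TypeB -> (i < j)%N ->
  word_perm ((up j.+1 (n - 1) ++ up i.+1 (n - 2)) ++ [:: n; (n - 1)%N; n] ++
             (down (n - 2) i.+1 ++ down (n - 1) j.+1)) = refl_bar i j.
Proof.
move=> WB ij; have := ltn_ord j => jn.
have an : (n - 2 < n)%N by lia. have bn : (n - 1 < n)%N by lia.
have ba : Ordinal bn = (Ordinal an).+1 :> nat by rewrite /=; lia.
have b1 : (Ordinal bn).+1 = n by rewrite /=; lia.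
have neq := succ_neq ba.
rewrite bar_wordE word_perm_conj [word_perm [:: _; _; _]]/= mul1g.
rewrite (letter_last WB b1) (letter_refl ba) -conj_sq ?sign_change_sq //.
rewrite (@refl_flipJ _ _ _ (Ordinal an) (Ordinal bn)) => [|e|e].
- by apply: refl_barJ => e; have [] := bar_prefix_perm e ij ba b1.
- by rewrite sign_changeE (negPf neq) addbF.
- by rewrite sign_changeE eqxx addbT.
Qed.

Lemma sgl_word_perm i : W = TypeB ->
  word_perm (up i.+1 (n - 1) ++ [:: n] ++ down (n - 1) i.+1) = sign_change i.
Proof.
move=> WB; have := ltn_ord i => jn; have bn : (n - 1 < n)%N by lia.
have b1 : (Ordinal bn).+1 = n by rewrite /=; lia.
rewrite down_rev word_perm_conj /= mul1g (letter_last WB b1).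
by apply: sign_changeJ => e; rewrite (@word_perm_up i (Ordinal bn)) //=; lia.
Qed.

(** ** Orders of products of simple reflections *)

Lemma order_letters_braid k : (0 < k)%N -> (k.+1 < n)%N ->
  #[letter_perm k * letter_perm k.+1] = 3.
Proof.
move=> k0 kn; have a1 : (k.-1 < n)%N by lia. have b1 : (k < n)%N by lia.
rewrite (letter_refl (a := Ordinal a1) (b := Ordinal b1)) /=; last by lia.
rewrite (letter_refl (a := Ordinal b1) (b := Ordinal kn)) //=.
by apply: order_refl_refl; rewrite -(inj_eq val_inj) /=; lia.
Qed.

Lemma order_letters_far k l : (0 < k)%N -> (k.+1 < l)%N -> (l < n)%N ->
  #[letter_perm k * letter_perm l] = 2.
Proof.
move=> k0 kl ln; have a1 : (k.-1 < n)%N by lia. have b1 : (k < n)%N by lia.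
have c1 : (l.-1 < n)%N by lia.
rewrite (letter_refl (a := Ordinal a1) (b := Ordinal b1)) /=; last by lia.
rewrite (letter_refl (a := Ordinal c1) (b := Ordinal ln)) /=; last by lia.
by apply: order_refl_far; rewrite -(inj_eq val_inj) /=; lia.
Qed.

Lemma order_letters_B k : W = TypeB -> (0 < k)%N -> (k < n)%N ->
  #[letter_perm k * letter_perm n] = (if k.+1 == n then 4 else 2).
Proof.
move=> WB k0 kn; have a1 : (k.-1 < n)%N by lia. have c1 : (n.-1 < n)%N by lia.
rewrite (letter_refl (a := Ordinal a1) (b := Ordinal kn)) /=; last by lia.
rewrite (letter_last (a := Ordinal c1) WB) /=; last by lia.
case: eqP => kn1.
  have -> : Ordinal c1 = Ordinal kn by apply: val_inj => /=; lia.
  by apply: order_refl_sign; rewrite -(inj_eq val_inj) /=; lia.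
by apply: order_refl_sign_far; rewrite -(inj_eq val_inj) /=; lia.
Qed.

Lemma order_letters_D k : W = TypeD -> (0 < k)%N -> (k < n)%N ->
  #[letter_perm k * letter_perm n] = (if k.+2 == n then 3 else 2).
Proof.
move=> WD k0 kn; have a1 : (k.-1 < n)%N by lia.
have c1 : (n - 2 < n)%N by lia. have d1 : (n.-1 < n)%N by lia.
rewrite (letter_refl (a := Ordinal a1) (b := Ordinal kn)) /=; last by lia.
rewrite (letter_last_bar (a := Ordinal c1) (b := Ordinal d1) WD) /=; [|lia|lia].
case: eqP => kn2.
  have -> : Ordinal c1 = Ordinal kn by apply: val_inj => /=; lia.
  by apply: order_refl_refl_bar; rewrite -(inj_eq val_inj) /=; lia.
have [kn1|kn1] := eqVneq k.+1 n; last first.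
  by apply: order_refl_bar_far; rewrite -(inj_eq val_inj) /=; lia.
have -> : Ordinal c1 = Ordinal a1 by apply: val_inj => /=; lia.
have -> : Ordinal d1 = Ordinal kn by apply: val_inj => /=; lia.
by apply: order_refl_bar_same; rewrite -(inj_eq val_inj) /=; lia.
Qed.

(** ** The symmetric group in the Weyl group *)

(** All transpositions lift to [W], so a [W]-invariant polynomial is symmetric. *)
Lemma refl_weyl i j : i != j -> refl i j \in weyl n W.
Proof.
move=> ij; rewrite inE; apply/andP; split.
  by apply/forallP => p; rewrite (signed_refl ij).
have flips0 k : flips (refl i j) k = false by rewrite /flips reflE.
case: W => //; first by apply/forallP => k; rewrite flips0.
by rewrite (eq_card0 (A := [set _ | _])) // => k; rewrite inE flips0.
Qed.

Lemma star_refl i j k : i != j -> star (refl i j) k = tperm i j k.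
Proof. by move=> ij; rewrite /star reflE. Qed.

End WordPerm.

Local Open Scope ring_scope.

(** * Evaluating polynomials at commuting elements of a ring *)

Section Evaluation.
Variables (F : fieldType) (n : nat).

Lemma mpoly_gen_ind (P : {mpoly F[n]} -> Prop) :
  P 1 -> (forall p q, P p -> P q -> P (p + q)) -> (forall k p, P p -> P (k *: p)) ->
  (forall p q, P p -> P q -> P (p * q)) -> (forall i, P 'X_i) -> forall p, P p.
Proof.
move=> P1 PD PZ PM PX; elim/mpolyind => [|k m p _ _ Pp].
  by rewrite -(scale0r (1 : {mpoly F[n]})); exact: PZ.
apply/PD => //; apply: PZ; rewrite mpolyXE_id.
elim/big_rec: _ => // i q _; apply: (PM).
by elim: (m i) => // d IH; rewrite exprS; apply: PM.
Qed.

Local Notation rename s := (comp_mpoly [tuple 'X_(s i) | i < n]).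

Lemma rename_var (s : 'I_n -> 'I_n) i : rename s ('X_i : {mpoly F[n]}) = 'X_(s i).
Proof. by rewrite comp_mpolyXU -tnth_nth tnth_mktuple. Qed.

Definition root_poly : {poly {mpoly F[n]}} := \prod_(i < n) ('X - ('X_i)%:P).

Lemma size_root_poly : size root_poly = n.+1.
Proof. by rewrite /root_poly size_prod_XsubC /index_enum -enumT size_enum_ord. Qed.

Lemma rename_root_poly (s : 'I_n -> 'I_n) k : injective s ->
  rename s root_poly`_k = root_poly`_k.
Proof.
move=> inj_s; rewrite -(coef_map (comp_mpoly [tuple 'X_(s i) | i < n])).
suff -> : map_poly (comp_mpoly [tuple 'X_(s i) | i < n]) root_poly = root_poly by [].
rewrite /root_poly rmorph_prod [RHS](reindex_inj inj_s); apply: eq_bigr => i _.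
by rewrite /= map_polyXsubC /= rename_var.
Qed.

Lemma root_polyE i :
  ('X_i : {mpoly F[n]}) ^+ n = - (\sum_(k < n) root_poly`_k * 'X_i ^+ k).
Proof.
have : root_poly.['X_i] = 0.
  rewrite /root_poly horner_prod; apply/eqP/prodf_eq0; exists i; first by [].
  by rewrite hornerXsubC subrr.
rewrite horner_coef size_root_poly big_ord_recr /=.
have -> : root_poly`_n = 1.
  have /monicP : root_poly \is monic by apply: monic_prod_XsubC.
  by rewrite /lead_coef size_root_poly.
by rewrite mul1r => /eqP; rewrite addrC addr_eq0 => /eqP.
Qed.

(** Restatements of the morphism laws that keep the bundled coercions out of the
    goals. *)
Lemma rename1 (s : 'I_n -> 'I_n) : rename s (1 : {mpoly F[n]}) = 1.
Proof. exact: rmorph1. Qed.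
Lemma renameD (s : 'I_n -> 'I_n) (p q : {mpoly F[n]}) :
  rename s (p + q) = rename s p + rename s q.
Proof. exact: rmorphD. Qed.
Lemma renameZ (s : 'I_n -> 'I_n) k (p : {mpoly F[n]}) :
  rename s (k *: p) = k *: rename s p.
Proof. exact: linearZ. Qed.
Lemma renameM (s : 'I_n -> 'I_n) (p q : {mpoly F[n]}) :
  rename s (p * q) = rename s p * rename s q.
Proof. exact: rmorphM. Qed.

(** [ev] stands for the evaluation at [a] in an algebra over [F] that may be the zero
    ring; [sc] is its structure morphism. *)
Variables (H : pzRingType) (sc : F -> H) (a : 'I_n -> H) (ev : {mpoly F[n]} -> H).
Hypothesis sc_central : forall k h, sc k * h = h * sc k.
Hypothesis ev1 : ev 1 = 1.
Hypothesis evD : forall p q, ev (p + q) = ev p + ev q.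
Hypothesis evZ : forall k p, ev (k *: p) = sc k * ev p.
Hypothesis evM : forall p q, ev (p * q) = ev p * ev q.
Hypothesis ev_var : forall i, ev 'X_i = a i.

Lemma ev0 : ev 0 = 0.
Proof. by apply: (addrI (ev 0)); rewrite -evD !addr0. Qed.

Lemma evN p : ev (- p) = - ev p.
Proof. by apply: (addrI (ev p)); rewrite -evD !subrr ev0. Qed.

Lemma ev_exp i k : ev ('X_i ^+ k) = a i ^+ k.
Proof. by elim: k => [|k IH]; rewrite ?expr0 // !exprS evM ev_var IH. Qed.

Lemma ev_sum I (r : seq I) P (f : I -> {mpoly F[n]}) :
  ev (\sum_(i <- r | P i) f i) = \sum_(i <- r | P i) ev (f i).
Proof. exact: (big_morph ev evD ev0). Qed.

Lemma ev_twist (s : 'I_n -> 'I_n) (r : H) p :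
  (forall i, r * a i = a (s i) * r) -> r * ev p = ev (rename s p) * r.
Proof.
move=> ra; elim/mpoly_gen_ind: p => [|p q IHp IHq|k p IHp|p q IHp IHq|i].
- by rewrite rename1 !ev1 mulr1 mul1r.
- by rewrite renameD !evD mulrDl mulrDr IHp IHq.
- by rewrite renameZ !evZ mulrA -sc_central -mulrA IHp mulrA.
- by rewrite renameM !evM mulrA IHp -mulrA IHq mulrA.
- by rewrite rename_var !ev_var ra.
Qed.

(** A polynomial evaluation moves past [h] by a divided-difference formula:
    the commutator with [h] is a derivation whose values [E j] on the [a j]
    intertwine the transposition of [i] and [j], and the coefficient [g j] of
    [E j] is forced to be the divided difference of [p].  The divided difference
    is given by the equation that it solves, which is stable under products by the
    twisted Leibniz rule. *)
Lemma ev_derivation (i : 'I_n) (h : H) (E : 'I_n -> H) p :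
  (forall j k, j != i -> E j * a k = a (tperm i j k) * E j) ->
  (forall j, j != i -> h * a j - a j * h = E j) ->
  h * a i - a i * h = - (\sum_(j | j != i) E j) ->
  exists2 g : 'I_n -> {mpoly F[n]},
    h * ev p - ev p * h = \sum_(j | j != i) ev (g j) * E j &
    forall j, j != i -> ('X_j - 'X_i) * g j = p - rename (tperm i j) p.
Proof.
move=> aE hE hi; elim/mpoly_gen_ind: p => [|p q|k p|p q|k].
- exists (fun=> 0) => [|j _]; last by rewrite mulr0 rename1 subrr.
  by rewrite ev1 mulr1 mul1r subrr big1 // => j _; rewrite ev0 mul0r.
- move=> [g1 d1 c1] [g2 d2 c2]; exists (fun j => g1 j + g2 j) => [|j ji].
    rewrite evD mulrDl mulrDr opprD addrACA d1 d2 -big_split /=.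
    by apply: eq_bigr => j _; rewrite evD mulrDl.
  by rewrite mulrDr c1 // c2 // renameD opprD addrACA.
- move=> [g d c]; exists (fun j => k *: g j) => [|j ji].
    rewrite evZ mulrA -sc_central -!mulrA -mulrBr d mulr_sumr.
    by apply: eq_bigr => j _; rewrite evZ mulrA.
  by rewrite -scalerAr c // scalerBr renameZ.
- move=> [g1 d1 c1] [g2 d2 c2].
  exists (fun j => g1 j * rename (tperm i j) q + p * g2 j) => [|j ji].
    have -> : h * ev (p * q) - ev (p * q) * h =
        (h * ev p - ev p * h) * ev q
        + ev p * (h * ev q - ev q * h).
      by rewrite evM mulrBl mulrBr !mulrA addrA subrK.
    rewrite d1 d2 mulr_suml mulr_sumr -big_split /=.
    apply: eq_bigr => j ji; rewrite evD !evM mulrDl -!mulrA.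
    by rewrite (ev_twist (s := tperm i j)) // => k; apply: aE.
  rewrite mulrDr mulrA c1 // mulrCA c2 // renameM mulrBl mulrBr.
  by rewrite addrC addrA subrK.
- case: (eqVneq k i) => [->|ki].
    exists (fun=> - 1) => [|j ji]; last first.
      by rewrite rename_var tpermL mulrN1 opprB.
    rewrite ev_var hi -sumrN; apply: eq_bigr => j _.
    by rewrite evN ev1 mulN1r.
  exists (fun j => (j == k)%:R) => [|j ji].
    rewrite ev_var hE // (bigD1 k) //= eqxx ev1 mul1r big1 ?addr0 //.
    by move=> j /andP[_ /negPf->]; rewrite ev0 mul0r.
  rewrite rename_var; case: (eqVneq j k) => [->|jk]; first by rewrite mulr1 tpermR.
  by rewrite mulr0 tpermD ?subrr // eq_sym.
Qed.

(** The divided differences of a symmetric polynomial vanish, as polynomials form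
    a domain. *)
Lemma ev_sym_comm (i : 'I_n) (h : H) (E : 'I_n -> H) p :
  (forall j k, j != i -> E j * a k = a (tperm i j k) * E j) ->
  (forall j, j != i -> h * a j - a j * h = E j) ->
  h * a i - a i * h = - (\sum_(j | j != i) E j) ->
  (forall j, rename (tperm i j) p = p) ->
  h * ev p = ev p * h.
Proof.
move=> aE hE hi sym_p; have [g d c] := ev_derivation p aE hE hi.
apply/eqP; rewrite -subr_eq0 d big1 // => j ji.
suff -> : g j = 0 by rewrite ev0 mul0r.
have/eqP := c j ji; rewrite sym_p subrr mulf_eq0 subr_eq0 => /orP[/eqP e|/eqP //].
have := congr1 (mpoly.mcoeff U_(j)) e.
by rewrite !mcoeffXU eqxx eq_sym (negPf ji) => /eqP; rewrite oner_eq0.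
Qed.

(** Each [a i] is a root of the polynomial whose roots are all the [a j]. *)
Lemma ev_root i :
  a i ^+ n = - (\sum_(k < n) ev root_poly`_k * a i ^+ k).
Proof.
rewrite -ev_exp root_polyE evN ev_sum; congr (- _).
by apply: eq_bigr => k _; rewrite evM ev_exp.
Qed.

End Evaluation.

(** * Weyl-invariant polynomials *)

Section WeylInvariant.
Variables (F : fieldType) (n : nat).
Local Notation rename s := (comp_mpoly [tuple 'X_(s i) | i < n]).

(** If two indices had the same image, then changing the sign of one of them if
    needed, [s] would merge two symbols. *)
Lemma star_inj (W : weyl_type) (s : sgn_perm n) : s \in weyl n W -> injective (star s).
Proof.
rewrite inE => /andP[/forallP sgn_s _] i j; rewrite /star => e.
have := sgn_s (j, false) => /eqP /= sj.
have pairE a b : a.1 = b.1 -> a.2 = b.2 -> a = b :> 'I_n * bool.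
  by case: a b => [? ?] [? ?] /= -> ->.
case: (boolP (flips s i == flips s j)) => [/eqP f|f].
  by have /perm_inj[] : s (i, false) = s (j, false) by apply: pairE.
suff /perm_inj[] : s (i, false) = s (j, true) by [].
rewrite sj; apply: pairE => //=.
by move: f; rewrite /flips; do 2!case: (_.2).
Qed.

Lemma weyl_invariant_root_poly (W : weyl_type) k : weyl_invariant W (root_poly F n)`_k.
Proof. by move=> s /star_inj inj_s; apply: rename_root_poly. Qed.

Lemma rename_id (p : {mpoly F[n]}) : rename id p = p.
Proof. exact: comp_mpoly_id. Qed.

Lemma eq_rename (s r : 'I_n -> 'I_n) (p : {mpoly F[n]}) : s =1 r -> rename s p = rename r p.
Proof.
move=> sr; congr comp_mpoly; apply: eq_from_tnth => i.
by rewrite !tnth_mktuple sr.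
Qed.

Lemma weyl_invariant_tperm (W : weyl_type) (p : {mpoly F[n]}) i j :
  weyl_invariant W p -> rename (tperm i j) p = p.
Proof.
move=> inv_p; case: (eqVneq i j) => [->|ij].
  by rewrite -[RHS]rename_id; apply: eq_rename => k; rewrite tperm1 perm1.
rewrite -[RHS](inv_p _ (refl_weyl W ij)).
by apply: eq_rename => k; rewrite star_refl.
Qed.

(** Forgetting signs, a simple reflection becomes a transposition or the identity. *)
Lemma weyl_invariant_letter (W : weyl_type) (p : {mpoly F[n]}) (o : 'I_(weyl_rank W n)) :
  admissible W n -> weyl_invariant W p -> rename (star (simple_refl o)) p = p.
Proof.
move=> hn inv_p.
have perm_case a b : star (simple_refl o) =1 tperm a b ->
    rename (star (simple_refl o)) p = p.
  by move=> e; rewrite (eq_rename _ e) (weyl_invariant_tperm _ _ inv_p).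
case: (simple_refl_cases hn o) => [[a [b [ba _ e]]]|[a [_ _ _ e]]|[a [b [_ ba _ [_ e]]]]].
- by apply: (perm_case a b) => k; rewrite e star_refl // succ_neq.
- apply: (perm_case a a) => k; rewrite e tperm1 perm1.
  by rewrite /star sign_changeE.
- by apply: (perm_case a b) => k; rewrite e /star refl_barE // succ_neq.
Qed.

End WeylInvariant.

(** * Coxeter words up to sign *)

Section Sign.
Variable R : pzRingType.
Implicit Types (a b c d z : R) (V : R -> Prop).

Definition pm a b := a = b \/ a = - b.
Local Notation "a =pm b" := (pm a b) (at level 70).

#[local] Instance pm_equiv : Equivalence pm.
Proof.
split=> [a|a b [->|->]|a b c [->|->] [->|->]]; rewrite /pm ?opprK; by auto.
Qed.

#[local] Instance pm_mul : Proper (pm ==> pm ==> pm) (@GRing.mul R).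
Proof.
by move=> a a' [->|->] b b' [->|->]; rewrite /pm ?mulrN ?mulNr ?opprK; auto.
Qed.

Lemma pmxx a : a =pm a. Proof. by left. Qed.
#[local] Hint Resolve pmxx : core.

(** A finite group with a sign, seen as a set of ring elements: the image of a
    central extension by [{1, -1}]. *)
Record sign_monoid V : Prop := SignMonoid {
  sm1 : V 1;
  sm_pm : forall a b, a =pm b -> V b -> V a;
  smM : forall a b, V a -> V b -> V (a * b) }.

Definition pm_finite V := exists s : seq R, forall a, V a -> exists2 b, b \in s & a =pm b.

(** The union of [V] with one double coset and one coset.  When [c] is the next letter
    of a chain of Coxeter generators and [z] is a suitable conjugate, these are
    all the double cosets of [V] in the group generated by [V] and [c]. *)
Definition adjoin V c z a :=
  [\/ V a, exists p q, [/\ V p, V q & a =pm p * c * q] | exists2 p, V p & a =pm p * z].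

(** [w] moves past [a] at the cost of changing [a] within [V]. *)
Definition passes w V a := exists2 a', V a' & w * a =pm a' * w.

Lemma passes_pm w V a b : a =pm b -> passes w V b -> passes w V a.
Proof. by move=> ab [a' Va' e]; exists a'; rewrite // ab. Qed.

Lemma passesM w V a b : sign_monoid V ->
  passes w V a -> passes w V b -> passes w V (a * b).
Proof.
move=> mV [a' Va' ea] [b' Vb' eb]; exists (a' * b'); first exact: smM.
by rewrite mulrA ea -mulrA eb mulrA.
Qed.

(** The conditions under which adjoining [c] gives a monoid again.  The element [z]
    is the one adjoined at the previous stage: in type B it is the sign change of
    the last index reached, so that [c * z * c] is the next sign change, which
    centralizes [V]; in type A it is [1]; in type D it is a product of two sign
    changes, and [c * z * c] only normalizes [V]. *)
Record adjoinable V c z : Prop := Adjoinable {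
  adj_monoid : sign_monoid V;
  adj_z : V z;
  adj_sq : c * c =pm 1;
  adj_conj : forall a, V a -> adjoin V c (c * z * c) (c * a * c);
  adj_norm : forall a, V a -> passes (c * z * c) V a }.

Lemma adjoin_pm V c z a b : sign_monoid V -> a =pm b -> adjoin V c z b -> adjoin V c z a.
Proof.
move=> mV ab [Vb|[p [q [Vp Vq e]]]|[p Vp e]].
- by constructor 1; apply: sm_pm Vb.
- by constructor 2; exists p, q; split=> //; rewrite ab.
- by constructor 3; exists p => //; rewrite ab.
Qed.

Lemma adjoin_monoid V c z : adjoinable V c z -> sign_monoid (adjoin V c (c * z * c)).
Proof.
move=> [mV Vz cc cVc nV]; set U := adjoin _ _ _.
have UV a b : U a -> V b -> U (a * b).
  move=> [Va|[p [q [Vp Vq e]]]|[p Vp e]] Vb.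
  - by constructor 1; apply: smM.
  - constructor 2; exists p, (q * b); split=> //; first exact: smM.
    by rewrite e !mulrA.
  - have [b' Vb' e'] := nV b Vb; constructor 3; exists (p * b'); first exact: smM.
    by rewrite e -mulrA e' !mulrA.
have VU a b : V a -> U b -> U (a * b).
  move=> Va [Vb|[p [q [Vp Vq e]]]|[p Vp e]].
  - by constructor 1; apply: smM.
  - constructor 2; exists (a * p), q; split=> //; first exact: smM.
    by rewrite e !mulrA.
  - constructor 3; exists (a * p); first exact: smM.
    by rewrite e !mulrA.
have Uc a : U a -> U (a * c).
  move=> [Va|[p [q [Vp Vq e]]]|[p Vp e]].
  - by constructor 2; exists a, 1; split=> //; [exact: sm1 | rewrite mulr1].
  - apply: (adjoin_pm mV (b := p * (c * q * c))); first by rewrite e !mulrA.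
    exact/VU/cVc.
  - constructor 2; exists p, z; split=> //.
    by rewrite e -!mulrA cc mulr1.
split=> [|a b|a b Ua [Vb|[p [q [Vp Vq e]]]|[p Vp e]]].
- by constructor 1; apply: sm1.
- exact: adjoin_pm.
- exact: UV.
- apply: (adjoin_pm mV (b := a * p * c * q)); first by rewrite e !mulrA.
  exact: (UV _ _ (Uc _ (UV _ _ Ua Vp)) Vq).
- apply: (adjoin_pm mV (b := a * p * c * z * c)); first by rewrite e !mulrA.
  exact: (Uc _ (UV _ _ (Uc _ (UV _ _ Ua Vp)) Vz)).
Qed.

Lemma adjoin_finite V c z : pm_finite V -> pm_finite (adjoin V c z).
Proof.
move=> [s hs].
exists (s ++ [seq p * c * q | p <- s, q <- s] ++ [seq p * z | p <- s]) => a.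
move=> [/hs[b sb e]|[p [q [/hs[p' sp ep] /hs[q' sq eq] e]]]|[p /hs[p' sp ep] e]].
- by exists b; rewrite ?mem_cat ?sb.
- exists (p' * c * q'); last by rewrite e ep eq.
  by rewrite !mem_cat (allpairs_f (fun p q => p * c * q)) ?orbT.
- exists (p' * z); last by rewrite e ep.
  by rewrite !mem_cat (map_f (fun p => p * z)) ?orbT.
Qed.

(** The conditions pass from a letter [c] to the next letter [d] when [d] commutes
    with all letters but [c]. *)
Lemma adjoinable_step V c d z :
  adjoinable V c z -> d * d =pm 1 -> d * c * d =pm c * d * c ->
  (forall a, V a -> d * a =pm a * d) ->
  adjoinable (adjoin V c (c * z * c)) d (c * z * c).
Proof.
move=> adV dd dcd dV; have mU := adjoin_monoid adV; have [mV Vz cc cVc nV] := adV.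
set U := adjoin V c _ in mU *; set y := c * z * c.
have VU a : V a -> U a by constructor 1.
have Uc : U c by constructor 2; exists 1, 1; split; rewrite ?mul1r ?mulr1 //; apply: sm1.
have Uy : U y by constructor 3; exists 1; rewrite ?mul1r //; apply: sm1.
split=> // [a [Va|[p [q [Vp Vq e]]]|[p Vp e]]|].
- constructor 1; apply/VU; apply: (sm_pm mV _ Va).
  by rewrite dV // -mulrA dd mulr1.
- constructor 2; exists (p * c), (c * q); split; try by apply: smM => //; apply: VU.
  rewrite e !mulrA dV // -!mulrA -(dV q) // !mulrA.
  have -> : p * d * c * d * q = p * (d * c * d) * q by rewrite !mulrA.
  by rewrite dcd !mulrA.
- constructor 3; exists p; first exact: VU.
  by rewrite e !mulrA dV.
set w := d * y * d.
have nVU a : V a -> passes w U a.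
  move=> Va; have [a' Va' e] := nV a Va; exists a'; first exact: VU.
  rewrite /w -(mulrA (d * y)) (dV a) // mulrA -(mulrA d) e.
  by rewrite !mulrA (dV a').
(* The braid relation, used twice, carries [w = d * c * z * c * d] across [c]. *)
have nc : passes w U c.
  exists c => //.
  have -> : w * c = d * c * z * (c * d * c) by rewrite /w /y !mulrA.
  have -> : c * w = c * d * c * (z * c * d) by rewrite /w /y !mulrA.
  rewrite -dcd; have -> : d * c * z * (d * c * d) = d * c * (z * d) * c * d.
    by rewrite !mulrA.
  by rewrite -(dV z) // !mulrA.
have ny : passes w U y by do 2!apply: passesM => //; exact: nVU.
move=> a [/nVU //|[p [q [Vp Vq e]]]|[p Vp e]].
- by apply: (passes_pm e); do 2?apply: passesM => //; exact: nVU.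
- by apply: (passes_pm e); apply: passesM => //; exact: nVU.
Qed.

Fixpoint adjoin_chain (b : nat -> R) V z k : (R -> Prop) * R :=
  if k is k'.+1 then
    let: (V', z') := adjoin_chain b V z k' in
    (adjoin V' (b k') (b k' * z' * b k'), b k' * z' * b k')
  else (V, z).

(** Here [b 0, b 1, ...] are the letters adjoined one by one to the base [V]; only the
    first of them interacts with [V] otherwise than by commuting. *)
Lemma adjoin_chain_finite (b : nat -> R) V z N :
  sign_monoid V -> pm_finite V -> ((0 < N)%N -> adjoinable V (b 0%N) z) ->
  (forall k, (k < N)%N -> b k * b k =pm 1) ->
  (forall k, (k.+1 < N)%N -> b k.+1 * b k * b k.+1 =pm b k * b k.+1 * b k) ->
  (forall k l, (l < N)%N -> (k.+1 < l)%N -> b l * b k =pm b k * b l) ->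
  (forall k a, (0 < k < N)%N -> V a -> b k * a =pm a * b k) ->
  exists U, [/\ sign_monoid U, pm_finite U, forall a, V a -> U a &
               forall k, (k < N)%N -> U (b k)].
Proof.
move=> mV fV adV bb braid far farV.
pose S k := adjoin_chain b V z k.
have SE k : S k.+1 = (adjoin (S k).1 (b k) (b k * (S k).2 * b k),
                      b k * (S k).2 * b k).
  by rewrite /S /=; case: adjoin_chain.
have farZ k l : (k < l)%N -> (l < N)%N -> b l * (S k).2 =pm (S k).2 * b l.
  move=> + lN; elim: k => [|k IH] kl.
    by apply: farV; rewrite ?kl //; exact: adj_z (adV (leq_ltn_trans (leq0n l) lN)).
  by rewrite SE /= !mulrA far // -(mulrA (b k)) IH ?(ltnW kl) // -!mulrA far.
have farS k l a : (k < l)%N -> (l < N)%N -> (S k).1 a -> b l * a =pm a * b l.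
  move=> + lN; elim: k a => [|k IH] a kl; first by move=> Va; apply: farV; rewrite ?kl.
  have IHk a' := IH a' (ltnW kl); have bl := far k l lN kl; have zl := farZ _ _ kl lN.
  rewrite SE /= in zl *; set Z := _ * b k in zl *; 
    case=> [/IHk //|[p [q [/IHk ep /IHk eq e]]]|[p /IHk ep e]].
    by rewrite e !mulrA ep -(mulrA p) bl -!mulrA eq.
  by rewrite e mulrA ep -mulrA zl mulrA.
have adS k : (k < N)%N -> adjoinable (S k).1 (b k) (S k).2.
  elim: k => [|k IH] kN; first exact: adV.
  rewrite SE; apply: adjoinable_step; [exact/IH/ltnW | exact: bb | exact: braid |].
  by move=> a; apply: farS.
have mS k : (k <= N)%N -> sign_monoid (S k).1.
  by case: k => [//|k] kN; rewrite SE; apply: adjoin_monoid (adS k kN).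
have SU k l : (k <= l)%N -> forall a, (S k).1 a -> (S l).1 a.
  move=> /subnK <-; elim: (l - k)%N => // d IH a /IH; rewrite addSn SE.
  by constructor 1.
exists (S N).1; split; [exact: mS | | exact: (SU 0%N) | move=> k kN].
  by elim: N {bb braid far farV adV farZ farS adS mS} => // k IH; rewrite SE; apply: adjoin_finite.
apply: (SU k.+1) => //; rewrite SE; constructor 2; exists 1, 1.
by split; rewrite ?mul1r ?mulr1 //; exact: sm1 (mS k (ltnW kN)).
Qed.

Definition sign_pair c a := a =pm 1 \/ a =pm c.

Lemma sign_pair_monoid c : c * c =pm 1 -> sign_monoid (sign_pair c).
Proof.
move=> cc; split=> [|a b ab|a b]; rewrite /sign_pair; first by left.
  by rewrite ab.
by move=> [->|->] [->|->]; rewrite ?mul1r ?mulr1; auto.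
Qed.

Lemma sign_pair_finite c : pm_finite (sign_pair c).
Proof.
exists [:: 1; c] => a [e|e]; [exists 1 | exists c] => //; by rewrite !inE eqxx ?orbT.
Qed.

Definition letters_finite (b : nat -> R) N := exists U, [/\ sign_monoid U, pm_finite U &
  forall k, (k < N)%N -> U (b k)].

(** The three Dynkin diagrams.  In types B and D the letters are numbered from the
    special end of the diagram: [b 0], [b 1] are the ends of the double bond in type
    B, and [b 0], [b 1] are the two short legs, both linked to [b 2], in type D. *)
Section Letters.
Variables (b : nat -> R) (N : nat).
Hypothesis bb : forall k, (k < N)%N -> b k * b k =pm 1.

Lemma letters_finite_A :
  (forall k, (k.+1 < N)%N -> b k.+1 * b k * b k.+1 =pm b k * b k.+1 * b k) ->
  (forall k l, (l < N)%N -> (k.+1 < l)%N -> b l * b k =pm b k * b l) ->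
  letters_finite b N.
Proof.
move=> braid far.
have one a : sign_pair 1 a -> a =pm 1 by case.
have mV : sign_monoid (sign_pair 1) by apply: sign_pair_monoid; rewrite mulr1.
case: (@adjoin_chain_finite b (sign_pair 1) 1 N) => //.
- exact: sign_pair_finite.
- move=> N0; split=> //; [by left | exact: bb | |].
    move=> a /one e; apply: (adjoin_pm mV (b := 1)); last by constructor 1; left.
    by rewrite e mulr1 bb.
  by move=> a /one e; exists 1; [left | rewrite e mulr1 mul1r].
- by move=> k a _ /one e; rewrite e mulr1 mul1r.
by move=> U [mU fU _ Ub]; exists U.
Qed.

Lemma letters_finite_B :
  ((1 < N)%N -> b 1 * b 0 * b 1 * b 0 =pm b 0 * b 1 * b 0 * b 1) ->
  (forall k, (0 < k)%N -> (k.+1 < N)%N ->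
     b k.+1 * b k * b k.+1 =pm b k * b k.+1 * b k) ->
  (forall k l, (l < N)%N -> (k.+1 < l)%N -> b l * b k =pm b k * b l) ->
  letters_finite b N.
Proof.
case: N bb => [|M] sq b10 braid far.
  exists (sign_pair 1); split=> //; last exact: sign_pair_finite.
  by apply: sign_pair_monoid; rewrite mulr1.
have mV : sign_monoid (sign_pair (b 0)) by apply: sign_pair_monoid; exact: sq.
case: (@adjoin_chain_finite (b \o S) (sign_pair (b 0)) (b 0) M) => //=.
- exact: sign_pair_finite.
- move=> M0; split=> //=; [by right | exact: sq | |] => a [e|e].
  + apply: (adjoin_pm mV (b := 1)); last by constructor 1; left.
    by rewrite e mulr1 sq.
  + constructor 3; exists 1; first by left.
    by rewrite e mul1r.
  + by exists 1; [left | rewrite e mulr1 mul1r].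
  + by exists (b 0); [right | rewrite e b10 // !mulrA].
- by move=> k kM; apply: sq.
- by move=> k kM; apply: braid.
- by move=> k l lM kl; apply: far.
- move=> k a /andP[k0 kM] [e|e]; first by rewrite e mulr1 mul1r.
  by rewrite e far.
move=> U [mU fU VU Ub]; exists U; split=> // -[_|k] //; last exact: Ub.
by apply: VU; right.
Qed.

Lemma letters_finite_D :
  ((1 < N)%N -> b 1 * b 0 =pm b 0 * b 1) ->
  ((2 < N)%N -> b 2 * b 0 * b 2 =pm b 0 * b 2 * b 0) ->
  (forall k, (0 < k)%N -> (k.+1 < N)%N ->
     b k.+1 * b k * b k.+1 =pm b k * b k.+1 * b k) ->
  (forall k l, (l < N)%N -> (k.+1 < l)%N -> (0 < k)%N || (2 < l)%N ->
     b l * b k =pm b k * b l) ->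
  (1 < N)%N -> letters_finite b N.
Proof.
case: N bb => [|[|M]] // sq b10 b20 braid far _.
have mV0 : sign_monoid (sign_pair (b 0)) by apply: sign_pair_monoid; exact: sq.
have comm0 q : sign_pair (b 0) q -> b 1 * q =pm q * b 1.
  by case=> ->; rewrite ?mulr1 ?mul1r // b10.
have adV0 : adjoinable (sign_pair (b 0)) (b 1) 1.
  split=> //; [by left | exact: sq | move=> a Va | move=> a Va].
    apply: (adjoin_pm mV0 (b := a)); last by constructor 1.
    by rewrite comm0 // -mulrA sq // mulr1.
  by exists a => //; rewrite mulr1 sq // mul1r mulr1.
have mV := adjoin_monoid adV0.
set V := adjoin _ _ _ in mV.
have VP a : V a -> exists2 p, sign_pair (b 0) p & a =pm p \/ a =pm p * b 1.
  case=> [Va|[p [q [Vp Vq e]]]|[p Vp e]].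
  - by exists a => //; left.
  - exists (p * q); first exact: smM.
    by right; rewrite e -!mulrA comm0.
  - by exists p => //; left; rewrite e mulr1 sq // mulr1.
have V0 : V (b 0) by constructor 1; right.
have V1 : V (b 1).
  by constructor 2; exists 1, 1; split; rewrite ?mul1r ?mulr1 //; left.
case: (@adjoin_chain_finite (fun k => b k.+2) V (b 0 * b 1) M) => //=.
- exact/adjoin_finite/sign_pair_finite.
- move=> M0.
  set w := b 2 * (b 0 * b 1) * b 2.
  (* Conjugation by [w] exchanges the two short legs of the diagram. *)
  have n0 : passes w V (b 0).
    exists (b 1) => //; rewrite /w -(b10 isT).
    have -> : b 2 * (b 1 * b 0) * b 2 * b 0 = b 2 * b 1 * (b 0 * b 2 * b 0).
      by rewrite !mulrA.
    by rewrite -b20 // !mulrA braid.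
  have n1 : passes w V (b 1).
    exists (b 0) => //.
    have -> : w * b 1 = b 2 * b 0 * (b 1 * b 2 * b 1) by rewrite /w !mulrA.
    by rewrite -braid // /w !mulrA b20.
  have n p : sign_pair (b 0) p -> passes w V p.
    case=> e; apply: (passes_pm e) => //.
    by exists 1; [exact: sm1 | rewrite mulr1 mul1r].
  split=> //; [exact: smM | exact: sq | |] => a /VP[p Vp].
    case: Vp => ep [e|e].
    + constructor 1; apply: (sm_pm mV (b := 1)); last exact: sm1.
      by rewrite e ep mulr1 sq.
    + constructor 2; exists (b 1), (b 1); split=> //.
      by rewrite e ep mul1r braid.
    + constructor 2; exists (b 0), (b 0); split=> //.
      by rewrite e ep b20.
    + constructor 3; exists 1; first exact: sm1.
      by rewrite e ep mul1r.
  case=> e; apply: (passes_pm e); first exact: n.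
  by apply: passesM => //; exact: n.
- by move=> k kM; apply: sq.
- by move=> k kM; apply: braid.
- by move=> k l lM kl; apply: far; rewrite ?orbT.
- move=> k a /andP[k0 kM] /VP[p Vp].
  have kp : b k.+2 * p =pm p * b k.+2.
    by case: Vp => ->; rewrite ?mulr1 ?mul1r // far // !ltnS k0 orbT.
  by case=> e; rewrite e // mulrA kp -!mulrA far.
move=> U [mU fU VU Ub]; exists U; split=> // -[|[|k]] kM; last exact: Ub.
  exact: VU.
exact: VU.
Qed.

End Letters.
End Sign.

Local Notation "a =pm b" := (pm a b) (at level 70).
#[local] Existing Instance pm_equiv.
#[local] Existing Instance pm_mul.
#[local] Hint Resolve pmxx : core.

(** * Module-finiteness over a central subring *)

Record central_subring (R : pzRingType) (Z : R -> Prop) : Prop := CentralSubring {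
  central1 : Z 1;
  centralD : forall z z', Z z -> Z z' -> Z (z + z');
  centralN : forall z, Z z -> Z (- z);
  centralM : forall z z', Z z -> Z z' -> Z (z * z');
  centralC : forall z a, Z z -> z * a = a * z }.

Section Span.
Variables (R : pzRingType) (Z : R -> Prop).
Hypothesis hZ : central_subring Z.
Let Z1 := central1 hZ.
Let ZN := centralN hZ.
Let ZM := centralM hZ.
Let ZC := centralC hZ.
Implicit Types (a b c d z h : R) (P Q : R -> Prop).

Inductive zspan P : R -> Prop :=
| zspan0 : zspan P 0
| zspanZD z a h : Z z -> P a -> zspan P h -> zspan P (z * a + h).

Lemma zspan_mem P a : P a -> zspan P a.
Proof.
move=> Pa; rewrite -[a]addr0 -[a]mul1r.
by apply: zspanZD => //; constructor.
Qed.

Lemma zspanD P a b : zspan P a -> zspan P b -> zspan P (a + b).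
Proof.
move=> Pa Pb; elim: Pa => [|z c h Zz Pc _ IH]; first by rewrite add0r.
by rewrite -addrA; apply: zspanZD.
Qed.

Lemma zspanZ P z a : Z z -> zspan P a -> zspan P (z * a).
Proof.
move=> Zz; elim=> [|z' c h Zz' Pc _ IH]; first by rewrite mulr0; constructor.
by rewrite mulrDr mulrA; apply: zspanZD => //; apply: ZM.
Qed.

Lemma zspanN P a : zspan P a -> zspan P (- a).
Proof. by rewrite -mulN1r; apply/zspanZ/ZN. Qed.

Lemma zspan_pm P a b : a =pm b -> zspan P b -> zspan P a.
Proof. by case=> ->; last exact: zspanN. Qed.

(** Additivity reduces a closure property of a span to its generators. *)
Lemma zspan_morph P Q (f : R -> R) :
  (forall a b, f (a + b) = f a + f b) -> (forall z a, Z z -> f (z * a) = z * f a) ->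
  (forall a, P a -> zspan Q (f a)) -> forall a, zspan P a -> zspan Q (f a).
Proof.
move=> fD fZ fP a; elim=> [|z b h Zz Pb _ IH].
  have -> : f 0 = 0 by apply: (addrI (f 0)); rewrite -fD !addr0.
  by constructor.
by rewrite fD fZ //; apply: zspanD => //; apply/zspanZ/fP.
Qed.

Lemma zspan_sub P Q a : (forall b, P b -> zspan Q b) -> zspan P a -> zspan Q a.
Proof. by move=> PQ; apply: (zspan_morph (f := fun b => b) _ _ PQ). Qed.

Lemma zspan_mulr P Q b a : (forall c, P c -> zspan Q (c * b)) ->
  zspan P a -> zspan Q (a * b).
Proof.
move=> PQ; apply: (zspan_morph (f := fun c => c * b) _ _ PQ) => [? ?|z c _].
  exact: mulrDl.
by rewrite mulrA.
Qed.

Lemma zspan_mull P Q b a : (forall c, P c -> zspan Q (b * c)) ->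
  zspan P a -> zspan Q (b * a).
Proof.
move=> PQ; apply: (zspan_morph (f := fun c => b * c) _ _ PQ) => [? ?|z c Zz].
  exact: mulrDr.
by rewrite !mulrA (ZC b Zz).
Qed.

Lemma zspanM P Q S a b : (forall c d, P c -> Q d -> zspan S (c * d)) ->
  zspan P a -> zspan Q b -> zspan S (a * b).
Proof.
move=> PQ Pa Qb; apply: zspan_mulr Pa => c Pc.
by apply: zspan_mull Qb => d; apply: PQ.
Qed.

Definition mul_set P Q a := exists p q, [/\ P p, Q q & a = p * q].

Definition zfinite P := exists gs : seq R, forall a, P a -> zspan [in gs] a.

Lemma zfinite_sub P Q : (forall a, P a -> zspan Q a) -> zfinite Q -> zfinite P.
Proof. by move=> PQ [gs hs]; exists gs => a /PQ; apply: zspan_sub. Qed.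

Lemma zfinite_mul P Q : zfinite P -> zfinite Q -> zfinite (mul_set P Q).
Proof.
move=> [gs Pg] [hs Qh]; exists [seq p * q | p <- gs, q <- hs] => _ [p [q [Pp Qq ->]]].
apply: zspanM (Pg p Pp) (Qh q Qq) => c d gc hd.
by apply/zspan_mem/allpairs_f.
Qed.

Lemma zfinite_pm P : pm_finite P -> zfinite P.
Proof.
move=> [s Ps]; exists s => a /Ps[b sb ab].
by apply: zspan_pm ab _; apply: zspan_mem.
Qed.

Definition powers a b := exists k, b = a ^+ k.

(** A monic equation with coefficients in [Z] bounds the exponents. *)
Lemma zfinite_powers N a : zspan [in [seq a ^+ k | k <- iota 0 N]] (a ^+ N) ->
  zfinite (powers a).
Proof.
set gs := [seq _ | _ <- _] => aN; exists gs => _ [k ->].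
elim: k => [|k IH].
  case: N @gs aN => [|N] gs aN; first by rewrite expr0 in aN.
  by apply/zspan_mem/mapP; exists 0%N.
rewrite exprSr; apply: zspan_mulr IH => _ /mapP[i iN ->].
rewrite -exprSr; move: iN; rewrite mem_iota /= add0n leq_eqVlt => /orP[/eqP-> //|iN].
by apply/zspan_mem/mapP; exists i.+1; rewrite ?mem_iota.
Qed.

Inductive words P : R -> Prop :=
| words1 : words P 1
| wordsMr a g : words P a -> P g -> words P (a * g).

Lemma words_gen P g : P g -> words P g.
Proof. by move=> Pg; rewrite -[g]mul1r; apply: wordsMr => //; constructor. Qed.

Lemma wordsM P a b : words P a -> words P b -> words P (a * b).
Proof.
move=> Wa; elim=> [|c g _ IH Pg]; first by rewrite mulr1.
by rewrite mulrA; apply: wordsMr.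
Qed.

Lemma words_in P V a : sign_monoid V -> (forall g, P g -> V g) -> words P a -> V a.
Proof.
move=> mV PV; elim=> [|c g _ IH Pg]; first exact: sm1.
by apply: smM => //; apply: PV.
Qed.

Lemma words_comm P a c : (forall g, P g -> g * c =pm c * g) ->
  words P a -> a * c =pm c * a.
Proof.
move=> Pc; elim=> [|b g _ IH Pg]; first by rewrite mulr1 mul1r.
by rewrite -mulrA Pc // mulrA IH mulrA.
Qed.

Definition letters (I : eqType) (r : seq I) (g : I -> R) a := exists2 i, i \in r & a = g i.

(** Letters that commute up to sign can be sorted: all occurrences of one letter are
    brought to the front. *)
Lemma letters_word_split (I : eqType) (i : I) r (g : I -> R) a :
  (forall j k, g j * g k =pm g k * g j) -> words (letters (i :: r) g) a ->
  exists2 b, mul_set (powers (g i)) (words (letters r g)) b & a =pm b.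
Proof.
move=> gg; elim=> [|b _ _ [_ [p [q [[k ->] Wq ->]]] e] [j jr ->]].
  by exists 1; [exists 1, 1; split; rewrite ?mul1r //; [exists 0%N | constructor] | left].
case: (eqVneq j i) jr => [-> _|ji].
  exists (g i ^+ k.+1 * q).
    by exists (g i ^+ k.+1), q; split=> //; exists k.+1.
  have qi : q * g i =pm g i * q by apply: words_comm Wq => _ [l _ ->].
  by rewrite e -mulrA qi mulrA exprSr.
rewrite inE (negPf ji) => jr; exists (g i ^+ k * (q * g j)); last by rewrite e mulrA.
exists (g i ^+ k), (q * g j); split=> //; first by exists k.
by apply: wordsMr => //; exists j.
Qed.

Lemma zfinite_letters (I : eqType) (r : seq I) (g : I -> R) :
  (forall j k, g j * g k =pm g k * g j) -> (forall i, zfinite (powers (g i))) ->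
  zfinite (words (letters r g)).
Proof.
move=> gg fg; elim: r => [|i r IH].
  exists [:: 1] => a; elim=> [|b c _ _ [j]]; last by rewrite in_nil.
  by apply: zspan_mem; rewrite inE.
apply: zfinite_sub (zfinite_mul (fg i) IH) => a /(letters_word_split gg)[b Pb ab].
exact: zspan_pm ab (zspan_mem Pb).
Qed.

(** The normal form [X * E * C * T].  Multiplying it on the right by a letter, one
    moves the letter to its block; only an [x] meeting an [eta] leaves a correction,
    which has one [eta] fewer. *)
Section Triangular.
Variables (I K : eqType) (x eta c : I -> R) (t : K -> R) (rI : seq I) (rK : seq K).
Hypotheses (rI_full : forall i, i \in rI) (rK_full : forall k, k \in rK).
Local Notation PX := (words (letters rI x)).
Local Notation PE := (words (letters rI eta)).
Local Notation PC := (words (letters rI c)).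
Local Notation PT := (words (letters rK t)).
Local Notation Nf := (mul_set PX (mul_set PE (mul_set PC PT))).
Local Notation L := (zspan Nf).

Hypothesis t_c : forall k i, exists j, t k * c i =pm c j * t k.
Hypothesis t_x : forall k i, exists j, t k * x i =pm x j * t k.
Hypothesis t_eta : forall k i, exists j, t k * eta i =pm eta j * t k.
Hypothesis c_x : forall i j, c i * x j =pm x j * c i.
Hypothesis c_eta : forall i j, c i * eta j =pm eta j * c i.
Hypothesis eta_x : forall i j,
  zspan (mul_set PC PT) (eta i * x j - x j * eta i).

Lemma words_move (J : eqType) (rJ : seq J) (g : J -> R) (y : I -> R) a i :
  (forall k i, exists j, g k * y i =pm y j * g k) ->
  words (letters rJ g) a -> exists j, a * y i =pm y j * a.
Proof.
move=> gy Wa; elim: Wa i => [|b _ _ IH [k _ ->]] i.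
  by exists i; rewrite mul1r mulr1.
have [j e] := gy k i; have [l e'] := IH j; exists l.
by rewrite -mulrA e mulrA e' mulrA.
Qed.

Lemma normal_rmul_t a k : L a -> L (a * t k).
Proof.
apply: zspan_mulr => _ [p [_ [Pp [q [_ [Pq [r [s [Pr Ps ->]] ->]]] ->]]]].
apply: zspan_mem; exists p, (q * (r * (s * t k))); split=> //; last by rewrite !mulrA.
exists q, (r * (s * t k)); split=> //; exists r, (s * t k); split=> //.
by apply: wordsMr => //; exists k.
Qed.

Lemma normal_rmul_c a i : L a -> L (a * c i).
Proof.
apply: zspan_mulr => _ [p [_ [Pp [q [_ [Pq [r [s [Pr Ps ->]] ->]]] ->]]]].
have [j e] := words_move i t_c Ps.
apply: (zspan_pm (b := p * (q * (r * c j * s)))).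
  by rewrite -!mulrA e !mulrA.
apply: zspan_mem; exists p, (q * (r * c j * s)); split=> //.
exists q, (r * c j * s); split=> //; exists (r * c j), s; split=> //.
by apply: wordsMr => //; exists j.
Qed.

Lemma normal_rmul_eta a i : L a -> L (a * eta i).
Proof.
apply: zspan_mulr => _ [p [_ [Pp [q [_ [Pq [r [s [Pr Ps ->]] ->]]] ->]]]].
have [j e] := words_move i t_eta Ps.
have e' : r * eta j =pm eta j * r by apply: words_comm Pr => _ [k _ ->].
apply: (zspan_pm (b := p * (q * eta j * (r * s)))).
  by rewrite -!mulrA e (mulrA r) e' !mulrA.
apply: zspan_mem; exists p, (q * eta j * (r * s)); split=> //.
exists (q * eta j), (r * s); split=> //; last by exists r, s.
by apply: wordsMr => //; exists j.
Qed.

Lemma normal_rmul_CT a b : mul_set PC PT b -> L a -> L (a * b).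
Proof.
move=> [p [q [Pp Pq ->]]] La; rewrite mulrA.
have Lp : L (a * p).
  elim: Pp => [|d _ _ IH [i _ ->]]; first by rewrite mulr1.
  by rewrite mulrA; apply: normal_rmul_c.
elim: Pq => [|d _ _ IH [i _ ->]]; first by rewrite mulr1.
by rewrite mulrA; apply: normal_rmul_t.
Qed.

Lemma normal_lmul_X a p : PX p -> L a -> L (p * a).
Proof.
move=> Pp; apply: zspan_mull => _ [q [b [Pq Pb ->]]]; rewrite mulrA.
by apply: zspan_mem; exists (p * q), b; split=> //; apply: wordsM.
Qed.

(** Induction on the number of [eta]'s: the correction left by the last [eta] is a
    combination of words in the [c] and the [t] behind a shorter word in the
    [eta]. *)
Lemma normal_E_x q j : PE q -> L (q * x j).
Proof.
move=> Pq; elim: Pq j => [|b _ Pb IH [i _ ->]] j.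
  apply: zspan_mem; exists (x j), 1; split; rewrite ?mul1r ?mulr1 //.
    by apply: words_gen; exists j.
  do 2?[exists 1, 1; split; rewrite ?mulr1 //; try exact: words1].
have -> : b * eta i * x j = b * x j * eta i + b * (eta i * x j - x j * eta i).
  by rewrite mulrBr !mulrA addrC subrK.
apply: zspanD; first exact/normal_rmul_eta/IH.
apply: zspan_mull (eta_x i j) => d Pd; apply: normal_rmul_CT Pd _.
apply: zspan_mem; exists 1, b; split; rewrite ?mul1r //; first exact: words1.
exists b, 1; split; rewrite ?mulr1 //.
by exists 1, 1; split; rewrite ?mulr1 //; exact: words1.
Qed.

Lemma normal_rmul_x a i : L a -> L (a * x i).
Proof.
apply: zspan_mulr => _ [p [_ [Pp [q [_ [Pq [r [s [Pr Ps ->]] ->]]] ->]]]].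
have [j e] := words_move i t_x Ps.
have e' : r * x j =pm x j * r by apply: words_comm Pr => _ [k _ ->].
apply: (zspan_pm (b := p * (q * x j * (r * s)))).
  by rewrite -!mulrA e (mulrA r) e' !mulrA.
apply: normal_lmul_X Pp _; apply: normal_rmul_CT; first by exists r, s.
exact: normal_E_x.
Qed.

Lemma normal_form1 : L 1.
Proof.
apply: zspan_mem; do 3?[exists 1, 1; split; rewrite ?mulr1 //; try exact: words1].
Qed.

Lemma zfinite_normal :
  zfinite PX -> zfinite PE -> zfinite PC -> zfinite PT ->
  exists gs : seq R, forall a, L a -> zspan [in gs] a.
Proof.
move=> fX fE fC fT.
have [gs hs] := zfinite_mul fX (zfinite_mul fE (zfinite_mul fC fT)).
by exists gs => a; apply: zspan_sub.
Qed.

End Triangular.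

(** The coefficients in a [zspan] may be collected along the list. *)
Lemma zspan_coef (gs : seq R) a : zspan [in gs] a ->
  exists2 z : 'I_(size gs) -> R, (forall k, Z (z k)) & a = \sum_k z k * gs`_k.
Proof.
have Z0 : Z 0 by rewrite -(subrr (1 : R)); apply: (centralD hZ) => //; exact: ZN.
elim=> [|z g h Zz gg _ [z' Zz' ->]].
  by exists (fun=> 0) => //; rewrite big1 // => k _; rewrite mul0r.
have ig : (index g gs < size gs)%N by rewrite index_mem.
exists (fun k => (if k == Ordinal ig then z else 0) + z' k) => [k|].
  by apply: (centralD hZ) => //; case: eqP.
under [RHS]eq_bigr do rewrite mulrDl.
rewrite big_split /=; congr (_ + _).
rewrite (bigD1 (Ordinal ig)) //= eqxx nth_index // big1 ?addr0 //.
by move=> k /negPf->; rewrite mul0r.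
Qed.

End Span.

(** * The commutators of squares *)

(** In this part [r i j] and [rb i j] stand for the two odd reflections attached to
    [i, j], and [s i] for the one attached to [i] in type B; [t], [u] and [v] are the
    scalars of the algebra, seen as central elements. *)
Section CrossRelations.
Variables (R : pzRingType) (n : nat) (x eta c s : 'I_n -> R) (r rb : 'I_n -> 'I_n -> R).
Variables (t u v : R).
Implicit Types i j k : 'I_n.

Definition cross_elt i j := (1 + c i * c j) * r i j - (1 - c i * c j) * rb i j.

Lemma cross_elt_rb0 i j : rb i j = 0 -> cross_elt i j = (1 + c i * c j) * r i j.
Proof. by rewrite /cross_elt => ->; rewrite mulr0 subr0. Qed.

Hypotheses (tC : forall a, t * a = a * t) (uC : forall a, u * a = a * u)
  (vC : forall a, v * a = a * v).
Hypothesis cc : forall i j, i != j -> c i * c j = - (c j * c i).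
Hypothesis xx : forall i j, x i * x j = x j * x i.
Hypothesis ee : forall i j, i != j -> eta i * eta j = - (eta j * eta i).
Hypothesis ce : forall i j, c i * eta j = - (eta j * c i).
Hypothesis cx : forall i j, c i * x j = (-1) ^+ (i == j) * (x j * c i).
Hypothesis rx : forall i j k, i != j -> r i j * x k = x (tperm i j k) * r i j.
Hypothesis bx : forall i j k, i != j ->
  rb i j * x k = (-1) ^+ ((k == i) || (k == j)) * (x (tperm i j k) * rb i j).
Hypothesis re : forall i j k, i != j -> r i j * eta k = - (eta (tperm i j k) * r i j).
Hypothesis be : forall i j k, i != j -> rb i j * eta k = - (eta (tperm i j k) * rb i j).
Hypothesis rN : forall i j, i != j -> r j i = - r i j.
Hypothesis bS : forall i j, i != j -> rb j i = rb i j.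
Hypothesis sx : forall i k, s i * x k = (-1) ^+ (k == i) * (x k * s i).
Hypothesis se : forall i k, s i * eta k = - (eta k * s i).
Hypothesis ex : forall i j, i != j -> eta i * x j - x j * eta i = u * cross_elt i j.
Hypothesis exx : forall i, eta i * x i - x i * eta i =
  t * c i + u * (\sum_(k | k != i) cross_elt k i) + v * s i.

Lemma sqr_move (a b d : R) m : a * b = (-1) ^+ m * (d * a) -> a * b ^+ 2 = d ^+ 2 * a.
Proof.
move=> ab; have ms (e : R) : (-1) ^+ m * e = e * (-1) ^+ m by rewrite commr_sign.
rewrite !expr2 mulrA ab -!mulrA ab [d * ((-1) ^+ m * _)]mulrA -ms !mulrA -expr2 sqrr_sign.
by rewrite mul1r.
Qed.

Lemma sqr_moveN (a b d : R) : a * b = - (d * a) -> a * b ^+ 2 = d ^+ 2 * a.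
Proof. by move=> ab; apply: (@sqr_move _ _ _ 1); rewrite expr1 mulN1r. Qed.

Lemma c_x2 i k : c i * x k ^+ 2 = x k ^+ 2 * c i. Proof. exact: sqr_move (cx i k). Qed.
Lemma c_eta2 i k : c i * eta k ^+ 2 = eta k ^+ 2 * c i.
Proof. exact: sqr_moveN (ce i k). Qed.
Lemma x_x2 i k : x i * x k ^+ 2 = x k ^+ 2 * x i.
Proof. by rewrite expr2 mulrA xx -mulrA xx mulrA. Qed.
Lemma eta_eta2 i k : eta i * eta k ^+ 2 = eta k ^+ 2 * eta i.
Proof.
have [->|/ee] := eqVneq i k; first by rewrite -exprS -exprSr.
exact: sqr_moveN.
Qed.

Lemma x2_x2 i k : x i ^+ 2 * x k ^+ 2 = x k ^+ 2 * x i ^+ 2.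
Proof. exact/commr_sym/commrX/commr_sym/x_x2. Qed.
Lemma eta2_eta2 i k : eta i ^+ 2 * eta k ^+ 2 = eta k ^+ 2 * eta i ^+ 2.
Proof. exact/commr_sym/commrX/commr_sym/eta_eta2. Qed.

Lemma cross_move (w : 'I_n -> R) i j k : (forall i k, c i * w k = w k * c i) ->
  r i j * w k = w (tperm i j k) * r i j -> rb i j * w k = w (tperm i j k) * rb i j ->
  cross_elt i j * w k = w (tperm i j k) * cross_elt i j.
Proof.
move=> cw rw bw.
have ccw : c i * c j * w (tperm i j k) = w (tperm i j k) * (c i * c j).
  by rewrite -mulrA cw mulrA cw mulrA.
rewrite /cross_elt mulrBl mulrBr -(mulrA _ (r i j)) rw -(mulrA _ (rb i j)) bw !mulrA.
by rewrite [(1 + _) * w _]mulrDl [(1 - _) * w _]mulrBl [w _ * (1 + _)]mulrDr [w _ * (1 - _)]mulrBr ccw mul1r mulr1.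
Qed.

Lemma cross_x2 i j k : i != j ->
  cross_elt i j * x k ^+ 2 = x (tperm i j k) ^+ 2 * cross_elt i j.
Proof.
move=> ij; apply: (cross_move (w := fun k => x k ^+ 2)); first exact: c_x2.
  by apply: (@sqr_move _ _ _ 0); rewrite expr0 mul1r rx.
exact: sqr_move (bx _ ij).
Qed.

Lemma cross_eta2 i j k : i != j ->
  cross_elt i j * eta k ^+ 2 = eta (tperm i j k) ^+ 2 * cross_elt i j.
Proof.
move=> ij; apply: (cross_move (w := fun k => eta k ^+ 2)); first exact: c_eta2.
  exact: sqr_moveN (re _ ij).
exact: sqr_moveN (be _ ij).
Qed.

Lemma cross_eta i j k : i != j ->
  cross_elt i j * eta k = - (eta (tperm i j k) * cross_elt i j).
Proof.
move=> ij.
have cce l : c i * c j * eta l = eta l * (c i * c j).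
  by rewrite -mulrA ce mulrN mulrA ce mulNr opprK mulrA.
rewrite /cross_elt mulrBl mulrBr -(mulrA _ (r i j)) re // -(mulrA _ (rb i j)) be //.
rewrite !mulrN !mulrA [(1 + _) * eta _]mulrDl [(1 - _) * eta _]mulrBl [eta _ * (1 + _)]mulrDr.
by rewrite [eta _ * (1 - _)]mulrBr cce mul1r mulr1 opprD.
Qed.

(** This is the identity behind [D(y_i) = - sum_j D(y_j)].  Moving an [x] across
    [c i * c k] exchanges [P = 1 + c i * c k] and [Q = 1 - c i * c k], and
    exchanging [i] and [k] in [P * r - Q * rb] gives [- (Q * r + P * rb)]. *)
Lemma cross_x_swap i k : i != k ->
  cross_elt k i * x i + x i * cross_elt k i = - (cross_elt i k * x k + x k * cross_elt i k).
Proof.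
move=> ik; have ki : k != i by rewrite eq_sym.
pose P := 1 + c i * c k; pose Q := 1 - c i * c k.
have e1 : cross_elt i k = P * r i k - Q * rb i k by [].
have e2 : cross_elt k i = - (Q * r i k + P * rb i k).
  by rewrite /cross_elt rN // bS // (cc ki) !opprK mulrN opprD.
have cck l : l \in [:: i; k] -> c i * c k * x l = - (x l * (c i * c k)).
  rewrite !inE => /orP[] /eqP->; rewrite -mulrA cx.
    by rewrite (negPf ki) expr0 mul1r mulrA cx eqxx expr1 mulN1r mulNr mulrA.
  by rewrite eqxx expr1 mulN1r mulrN mulrA cx (negPf ik) expr0 mul1r mulrA.
have Px l : l \in [:: i; k] -> P * x l = x l * Q.
  by move=> /cck e; rewrite /P mulrDl e mul1r /Q mulrBr mulr1.
have Qx l : l \in [:: i; k] -> Q * x l = x l * P.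
  by move=> /cck e; rewrite /Q mulrBl e mul1r opprK /P mulrDr mulr1.
have ri : r i k * x i = x k * r i k by rewrite rx // tpermL.
have rk : r i k * x k = x i * r i k by rewrite rx // tpermR.
have bi : rb i k * x i = - (x k * rb i k).
  by rewrite bx // eqxx tpermL expr1 mulN1r.
have bk : rb i k * x k = - (x i * rb i k).
  by rewrite bx // eqxx orbT tpermR expr1 mulN1r.
have im : i \in [:: i; k] by rewrite inE eqxx.
have km : k \in [:: i; k] by rewrite !inE eqxx orbT.
rewrite e1 e2 mulNr mulrN -opprD; congr (- _); clearbody P Q.
rewrite mulrDl mulrDr mulrBl mulrBr -!mulrA ri rk bi bk !mulrN opprK.
rewrite (mulrA Q) Qx // (mulrA P (x k)) Px // (mulrA P (x i)) Px // (mulrA Q (x i)) Qx //.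
rewrite -!mulrA addrACA [RHS]addrACA [RHS]addrC.
by rewrite [RHS]addrC; congr (_ + _); exact: addrC.
Qed.

(** The commutators [[eta i, x j ^ 2]], on and off the diagonal, in the form that
    [ev_sym_comm] requires. *)
Lemma eta_x2_comm i j : i != j -> eta i * x j ^+ 2 - x j ^+ 2 * eta i =
  u * (cross_elt i j * x j + x j * cross_elt i j).
Proof.
move=> ij; have -> : eta i * x j ^+ 2 - x j ^+ 2 * eta i =
    (eta i * x j - x j * eta i) * x j + x j * (eta i * x j - x j * eta i).
  by rewrite !expr2 mulrBl mulrBr !mulrA addrA subrK.
rewrite ex //; move: (cross_elt i j) => X.
by rewrite mulrDr -!mulrA (mulrA (x j)) -uC -!mulrA.
Qed.

(** The terms in [t] and [v] drop out, since [c i] and [s i] anticommute with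
    [x i]. *)
Lemma eta_x2_diag i : eta i * x i ^+ 2 - x i ^+ 2 * eta i =
  - (\sum_(j | j != i) u * (cross_elt i j * x j + x j * cross_elt i j)).
Proof.
have -> : eta i * x i ^+ 2 - x i ^+ 2 * eta i =
    (eta i * x i - x i * eta i) * x i + x i * (eta i * x i - x i * eta i).
  by rewrite !expr2 mulrBl mulrBr !mulrA addrA subrK.
have z0 z a : (forall b, z * b = b * z) -> a * x i = - (x i * a) ->
    z * a * x i + x i * (z * a) = 0.
  by move=> zC ax; rewrite -mulrA ax mulrN (mulrA (x i)) -zC -mulrA addNr.
have tc0 : t * c i * x i + x i * (t * c i) = 0.
  by apply: z0 => //; rewrite cx eqxx expr1 mulN1r.
have vs0 : v * s i * x i + x i * (v * s i) = 0.
  by apply: z0 => //; rewrite sx eqxx expr1 mulN1r.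
rewrite exx !mulrDl !mulrDr addrACA vs0 addr0 addrACA tc0 add0r.
rewrite -mulrA (mulrA (x i)) -uC -mulrA -mulrDr mulr_suml mulr_sumr -big_split /=.
rewrite mulr_sumr -sumrN; apply: eq_bigr => k ki.
have ik : i != k by rewrite eq_sym; exact: ki.
by rewrite (cross_x_swap ik) mulrN.
Qed.

Lemma eta_x2_twist i j k : i != j ->
  u * (cross_elt i j * x j + x j * cross_elt i j) * x k ^+ 2 =
  x (tperm i j k) ^+ 2 * (u * (cross_elt i j * x j + x j * cross_elt i j)).
Proof.
move=> ij; have := cross_x2 k ij; have := x_x2 j (tperm i j k); have := x_x2 j k.
move: (x k ^+ 2) (x (tperm i j k) ^+ 2) (cross_elt i j) => y y' X xy xy' Xy.
rewrite -mulrA mulrDl -!mulrA xy Xy (mulrA X) Xy (mulrA (x j)) xy'.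
by rewrite -!mulrA -mulrDr mulrA uC -mulrA.
Qed.

(** The same for the commutators [[x j, eta i ^ 2]]. *)
Lemma x_eta2_comm i j : i != j -> x j * eta i ^+ 2 - eta i ^+ 2 * x j =
  - (u * (eta i * cross_elt i j + cross_elt i j * eta i)).
Proof.
move=> ij; rewrite -opprB; congr (- _).
have -> : eta i ^+ 2 * x j - x j * eta i ^+ 2 =
    eta i * (eta i * x j - x j * eta i) + (eta i * x j - x j * eta i) * eta i.
  by rewrite !expr2 mulrBl mulrBr !mulrA addrA subrK.
rewrite ex //; move: (cross_elt i j) => X.
by rewrite mulrDr mulrA -uC -!mulrA.
Qed.

(** Here [c j] and [s j] anticommute with [eta j], and the remaining terms match
    because the cross terms anticommute with the [eta]'s up to a transposition. *)
Lemma x_eta2_diag j : x j * eta j ^+ 2 - eta j ^+ 2 * x j =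
  - (\sum_(i | i != j) - (u * (eta i * cross_elt i j + cross_elt i j * eta i))).
Proof.
rewrite -opprB; congr (- _).
have -> : eta j ^+ 2 * x j - x j * eta j ^+ 2 =
    eta j * (eta j * x j - x j * eta j) + (eta j * x j - x j * eta j) * eta j.
  by rewrite !expr2 mulrBl mulrBr !mulrA addrA subrK.
have z0 z a : (forall b, z * b = b * z) -> a * eta j = - (eta j * a) ->
    eta j * (z * a) + z * a * eta j = 0.
  by move=> zC ax; rewrite -mulrA ax mulrN (mulrA (eta j)) -zC -mulrA subrr.
rewrite exx !mulrDl !mulrDr addrACA (z0 v) // addr0 addrACA (z0 t) // add0r.
rewrite mulrA -uC -!mulrA -mulrDr mulr_suml mulr_sumr -big_split /=.
rewrite mulr_sumr; apply: eq_bigr => i ij.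
rewrite !cross_eta // tpermL tpermR -[RHS]mulrN; congr (u * _).
by rewrite opprD opprK addrC.
Qed.

Lemma x_eta2_twist i j k : i != j ->
  - (u * (eta i * cross_elt i j + cross_elt i j * eta i)) * eta k ^+ 2 =
  eta (tperm i j k) ^+ 2 * - (u * (eta i * cross_elt i j + cross_elt i j * eta i)).
Proof.
move=> ij; rewrite mulNr mulrN; congr (- _).
have := cross_eta2 k ij; have := eta_eta2 i (tperm i j k); have := eta_eta2 i k.
move: (eta k ^+ 2) (eta (tperm i j k) ^+ 2) (cross_elt i j) => y y' X ey ey' Xy.
rewrite -mulrA mulrDl -!mulrA ey Xy (mulrA X) Xy (mulrA (eta i)) ey'.
by rewrite -!mulrA -mulrDr mulrA uC -mulrA.
Qed.

End CrossRelations.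

(** * Odd reflections *)

(** Only the way each letter moves past the [x] and the [eta] matters here; by
    induction a word moves them by its permutation, and the palindromic words of the
    odd reflections have the permutations computed above. *)
Section Brackets.
Variables (W : weyl_type) (n : nat) (R : pzRingType).
Variables (x eta c : 'I_n -> R) (T : nat -> R).
Implicit Types (i j k : 'I_n) (w : seq nat).

Definition word_elt w : R := \prod_(k <- w) T k.

Definition bracket i j : R :=
  let r (a b : nat) := (-1) ^+ (b - a - 1) * word_elt (down (b - 1) a ++ up (a + 1) (b - 1)) in
  if (i < j)%N then r i.+1 j.+1 else - r j.+1 i.+1.

Definition bar_bracket i j : R :=
  let r (a b : nat) :=
    let l := up b (n - 1) ++ up a (n - 2) in
    let l' := down (n - 2) a ++ down (n - 1) b in
    match W with
    | TypeA => 0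
    | TypeD => (-1) ^+ (b - a - 1) * word_elt (l ++ [:: n] ++ l')
    | TypeB => (-1) ^+ (b - a) * word_elt (l ++ [:: n; (n - 1)%N; n] ++ l')
    end in
  if (i < j)%N then r i.+1 j.+1 else r j.+1 i.+1.

Definition sgl_bracket i : R :=
  if W is TypeB then
    (-1) ^+ (n - i.+1) * word_elt (up i.+1 (n - 1) ++ [:: n] ++ down (n - 1) i.+1)
  else 0.

Definition signed_elt (a : 'I_n -> R) (p : 'I_n * bool) : R := if p.2 then - a p.1 else a p.1.

Hypothesis hn : admissible W n.
Hypothesis T_x : forall (k : nat) p, T k * signed_elt x p = signed_elt x (letter_perm W n k p) * T k.
Hypothesis T_eta : forall (k : nat) j, T k * eta j = - (eta (letter_perm W n k (j, false)).1 * T k).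

Lemma bracketN i j : i != j -> bracket j i = - bracket i j.
Proof.
by move=> ij; rewrite /bracket; case: ltngtP ij => //= [|/val_inj->]; rewrite ?opprK ?eqxx.
Qed.

Lemma bar_bracketC i j : i != j -> bar_bracket j i = bar_bracket i j.
Proof.
by move=> ij; rewrite /bar_bracket; case: ltngtP ij => //= /val_inj->; rewrite eqxx.
Qed.

Lemma word_elt_x w p :
  word_elt w * signed_elt x p = signed_elt x (word_perm W n w p) * word_elt w.
Proof.
rewrite /word_elt; elim: w p => [|k w IH] p; first by rewrite big_nil mulr1 mul1r perm1.
by rewrite big_cons -mulrA IH mulrA T_x -mulrA /= permM.
Qed.

Lemma word_elt_eta w j : word_elt w * eta j =
  (-1) ^+ (size w) * (eta (word_perm W n w (j, false)).1 * word_elt w).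
Proof.
rewrite /word_elt; elim: w => [|k w IH]; first by rewrite big_nil expr0 !mul1r mulr1 perm1.
rewrite big_cons -mulrA IH mulrA -commr_sign -!mulrA (mulrA (T k)) T_eta /= permM.
set p := word_perm _ _ _ _; rewrite exprS mulN1r !mulNr -commr_sign -!mulrA.
congr (- (eta _ * _)).
by case: p => a [] //=; rewrite -[true]/(~~ false) (letter_signed hn k (a, false)).
Qed.

(** Only the parity of the length counts, and a palindrome has the parity of its
    middle. *)
Lemma palindrome_eta l m j : odd (size m) ->
  word_elt (l ++ m ++ rev l) * eta j =
  - (eta (word_perm W n (l ++ m ++ rev l) (j, false)).1 * word_elt (l ++ m ++ rev l)).
Proof.
move=> om; rewrite word_elt_eta -signr_odd !size_cat size_rev addnCA addnn oddD odd_double.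
by rewrite om expr1 mulN1r.
Qed.

Lemma sgnC m (h : R) : (-1) ^+ m * h = h * (-1) ^+ m.
Proof. by rewrite commr_sign. Qed.

Lemma sgn_move m (a b d : R) : a * b = d * a -> (-1) ^+ m * a * b = d * ((-1) ^+ m * a).
Proof. by move=> ab; rewrite -mulrA ab !mulrA sgnC. Qed.

Lemma sgn_moveN m (a b d : R) : a * b = - (d * a) -> (-1) ^+ m * a * b = - (d * ((-1) ^+ m * a)).
Proof. by rewrite -!mulNr; apply: sgn_move. Qed.

Lemma word_elt_x0 w k : word_elt w * x k = signed_elt x (word_perm W n w (k, false)) * word_elt w.
Proof. by rewrite -(word_elt_x w (k, false)). Qed.

Lemma bracket_x i j k : i != j -> bracket i j * x k = x (tperm i j k) * bracket i j.
Proof.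
wlog ij : i j / (i < j)%N => [h|_].
  move=> ij; case: (ltngtP i j) (ij) => [ij'|ij'|/val_inj->]; last by rewrite eqxx.
    by move=> _; apply: h.
  by move=> ji; rewrite bracketN 1?eq_sym // mulNr h 1?eq_sym // mulrN tpermC.
have neq : i != j by rewrite -(inj_eq val_inj) neq_ltn ij.
rewrite /bracket ij; apply: sgn_move.
by rewrite word_elt_x0 brk_word_perm // reflE.
Qed.

Lemma bracket_eta i j k : i != j -> bracket i j * eta k = - (eta (tperm i j k) * bracket i j).
Proof.
wlog ij : i j / (i < j)%N => [h|_].
  move=> ij; case: (ltngtP i j) (ij) => [ij'|ij'|/val_inj->]; last by rewrite eqxx.
    by move=> _; apply: h.
  by move=> ji; rewrite bracketN 1?eq_sym // mulNr h 1?eq_sym // mulrN tpermC.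
have neq : i != j by rewrite -(inj_eq val_inj) neq_ltn ij.
rewrite /bracket ij; apply: sgn_moveN.
by rewrite brk_wordE // palindrome_eta // -brk_wordE // brk_word_perm // reflE.
Qed.

Lemma bar_bracket_x i j k : i != j -> bar_bracket i j * x k =
  (-1) ^+ ((k == i) || (k == j)) * (x (tperm i j k) * bar_bracket i j).
Proof.
wlog ij : i j / (i < j)%N => [h|_].
  move=> ij; case: (ltngtP i j) (ij) => [ij'|ij'|/val_inj->]; last by rewrite eqxx.
    by move=> _; apply: h.
  by move=> neq; have ji : j != i by [rewrite eq_sym]; rewrite (bar_bracketC ji) h // tpermC orbC.
have neq : i != j by rewrite -(inj_eq val_inj) neq_ltn ij.
rewrite mulrA /bar_bracket ij; have [WB|[WD|WA]] : W = TypeB \/ W = TypeD \/ W = TypeA by case: (W); auto.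
- rewrite WB; apply: sgn_move; rewrite word_elt_x0 bar_word_perm_B // refl_barE //.
  by congr (_ * _); rewrite /signed_elt /=; case: (_ || _); rewrite ?expr1 ?mulN1r ?expr0 ?mul1r.
- rewrite WD; apply: sgn_move; rewrite word_elt_x0 bar_word_perm_D // refl_barE //.
  by congr (_ * _); rewrite /signed_elt /=; case: (_ || _); rewrite ?expr1 ?mulN1r ?expr0 ?mul1r.
- by rewrite WA mulr0 mul0r.
Qed.

Lemma bar_bracket_eta i j k : i != j ->
  bar_bracket i j * eta k = - (eta (tperm i j k) * bar_bracket i j).
Proof.
wlog ij : i j / (i < j)%N => [h|_].
  move=> ij; case: (ltngtP i j) (ij) => [ij'|ij'|/val_inj->]; last by rewrite eqxx.
    by move=> _; apply: h.
  by move=> ji; rewrite bar_bracketC 1?eq_sym // h 1?eq_sym // tpermC.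
have neq : i != j by rewrite -(inj_eq val_inj) neq_ltn ij.
rewrite /bar_bracket ij; have [WB|[WD|WA]] : W = TypeB \/ W = TypeD \/ W = TypeA by case: (W); auto.
- rewrite WB; apply: sgn_moveN.
  by rewrite bar_wordE palindrome_eta // -bar_wordE // bar_word_perm_B // refl_barE.
- rewrite WD; apply: sgn_moveN.
  by rewrite bar_wordE palindrome_eta // -bar_wordE // bar_word_perm_D // refl_barE.
- by rewrite WA mulr0 mul0r oppr0.
Qed.

Lemma sgl_bracket_x i k : sgl_bracket i * x k = (-1) ^+ (k == i) * (x k * sgl_bracket i).
Proof.
rewrite mulrA /sgl_bracket; have [WB|WB] : W = TypeB \/ W <> TypeB by case: (W); [right|left|right].
  rewrite WB; apply: sgn_move; rewrite word_elt_x0 sgl_word_perm // sign_changeE.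
  by congr (_ * _); rewrite /signed_elt /=; case: (_ == _); rewrite ?expr1 ?mulN1r ?expr0 ?mul1r.
by case: (W) WB => //; rewrite mulr0 mul0r.
Qed.

Lemma sgl_bracket_eta i k : sgl_bracket i * eta k = - (eta k * sgl_bracket i).
Proof.
rewrite /sgl_bracket; have [WB|WB] : W = TypeB \/ W <> TypeB by case: (W); [right|left|right].
  rewrite WB; apply: sgn_moveN.
  by rewrite down_rev palindrome_eta // -down_rev sgl_word_perm // sign_changeE.
by case: (W) WB => //; rewrite mulr0 mul0r oppr0.
Qed.

End Brackets.

(** With [t_k ^ 2 = 1], the relation [(t_k * t_l) ^ m = (-1) ^ (m + 1)] is, up to sign,
    the braid relation of length [m]; up to sign the [t_k] thus satisfy the
    relations that make the Coxeter words finite in number. *)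
Section SpinFinite.
Variables (W : weyl_type) (n : nat) (R : pzRingType) (T : nat -> R).
Local Notation rank := (weyl_rank W n).
Local Notation lp := (letter_perm W n).
Implicit Types k l : nat.

Hypothesis hn : admissible W n.
Hypothesis T_rel : forall k l, (0 < k <= rank)%N -> (0 < l <= rank)%N ->
  let m := #[lp k * lp l]%g in (T k * T l) ^+ m = (-1) ^+ m.+1.

Lemma T_sq k : (0 < k <= rank)%N -> T k * T k = 1.
Proof.
move=> kr; have := T_rel kr kr.
by rewrite letter_sq // order1 /= expr1 exprS expr1 mulN1r opprK.
Qed.

Section Two.
Variables k l : nat.
Hypotheses (kr : (0 < k <= rank)%N) (lr : (0 < l <= rank)%N).

Lemma T_order2 : #[lp k * lp l]%g = 2 -> T k * T l = - (T l * T k).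
Proof.
move=> m2; have := T_rel kr lr; rewrite m2 /= !exprS expr0 !mulr1 !mulN1r opprK => e.
have kk := T_sq kr; have ll := T_sq lr; rewrite mulrA in e.
have -> : T k * T l = T k * T l * (T k * (T l * T l) * T k) by rewrite ll mulr1 kk mulr1.
by rewrite !mulrA e mulN1r mulNr.
Qed.

Lemma T_order3 : #[lp k * lp l]%g = 3 -> T k * T l * T k = T l * T k * T l.
Proof.
move=> m3; have := T_rel kr lr; rewrite m3 /= !exprS expr0 !mulr1 !mulN1r !opprK !mulrA => e.
have kk := T_sq kr; have ll := T_sq lr.
have -> : T k * T l * T k = T k * T l * T k * (T l * (T k * (T l * T l) * T k) * T l).
  by rewrite ll mulr1 kk mulr1 ll mulr1.
by rewrite !mulrA e mul1r.
Qed.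

Lemma T_order4 : #[lp k * lp l]%g = 4 -> T k * T l * T k * T l = - (T l * T k * T l * T k).
Proof.
move=> m4; have := T_rel kr lr; rewrite m4 /= !exprS expr0 !mulr1 !mulN1r !opprK !mulrA => e.
have kk := T_sq kr; have ll := T_sq lr.
have -> : T k * T l * T k * T l =
    T k * T l * T k * T l * (T k * (T l * (T k * (T l * T l) * T k) * T l) * T k).
  by rewrite ll mulr1 kk mulr1 ll mulr1 kk mulr1.
by rewrite !mulrA e !mulN1r !mulNr.
Qed.

End Two.

Lemma rank_le k : (0 < k)%N -> (k < n)%N -> (0 < k <= rank)%N.
Proof. by move=> -> kn /=; case: k kn => // k kn; apply: rank_lt. Qed.

Lemma T_braid k : (0 < k)%N -> (k.+1 < n)%N -> T k * T k.+1 * T k = T k.+1 * T k * T k.+1.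
Proof.
move=> k0 kn; apply: T_order3; try by apply: rank_le => //; lia.
exact: order_letters_braid.
Qed.

Lemma T_far k l : (0 < k)%N -> (k.+1 < l)%N -> (l < n)%N -> T k * T l = - (T l * T k).
Proof.
move=> k0 kl ln; apply: T_order2; try by apply: rank_le => //; lia.
exact: order_letters_far.
Qed.

Theorem spin_words_finite : exists U, [/\ sign_monoid U, pm_finite U &
  forall k, (0 < k <= rank)%N -> U (T k)].
Proof.
have pmN a b : a = - b -> a =pm b by right.
have pmE a b : a = b -> a =pm b by left.
have [WB|[WD|WA]] : W = TypeB \/ W = TypeD \/ W = TypeA by case: (W); auto.
- have nr : (0 < n)%N by move: hn; rewrite WB.
  have rn : rank = n by rewrite WB.
  have nn : (0 < n <= rank)%N by rewrite rn leqnn nr.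
  case: (@letters_finite_B R (fun k => T (n - k)%N) n) => [k kn|n1|k k0 kn|k l ln kl|U [mU fU TU]].
  + by apply/pmE/T_sq; lia.
  + rewrite subn0 -mulrA -(mulrA (T n)); apply: pmN.
    have kr : (0 < n - 1 <= rank)%N by lia.
    rewrite !mulrA; apply: T_order4 => //.
    by rewrite order_letters_B //; try lia; rewrite ifT //; apply/eqP; lia.
  + apply/pmE; have -> : (n - k = (n - k.+1).+1)%N by lia.
    by apply: T_braid; lia.
  + case: k kl => [|k] kl; last by apply/pmN/T_far; lia.
    rewrite subn0; apply/pmN/T_order2; try lia.
    by rewrite order_letters_B //; try lia; rewrite ifF //; apply/eqP; lia.
  exists U; split=> // k; rewrite rn => /andP[k0 kn].
  by have := TU (n - k)%N; rewrite subKn //; apply; lia.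
- have nr : (1 < n)%N by move: hn; rewrite WD.
  have rn : rank = n by rewrite WD.
  have nn : (0 < n <= rank)%N by rewrite rn leqnn ltnW.
  case: (@letters_finite_D R (fun k => T (n - k)%N) n) => [k kn|n1|n2|k k0 kn|k l ln kl kl2||U [mU fU TU]] //.
  + by apply/pmE/T_sq; lia.
  + rewrite subn0; apply/pmN/T_order2; try lia.
    by rewrite order_letters_D //; try lia; rewrite ifF //; apply/eqP; lia.
  + rewrite subn0; apply/pmE/T_order3; try lia.
    by rewrite order_letters_D //; try lia; rewrite ifT //; apply/eqP; lia.
  + apply/pmE; have -> : (n - k = (n - k.+1).+1)%N by lia.
    by apply: T_braid; lia.
  + case: k kl kl2 => [|k] kl kl2; last by apply/pmN/T_far; lia.
    rewrite subn0; apply/pmN/T_order2; try lia.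
    by rewrite order_letters_D //; try lia; rewrite ifF //; apply/eqP; lia.
  exists U; split=> // k; rewrite rn => /andP[k0 kn].
  by have := TU (n - k)%N; rewrite subKn //; apply; lia.
- have rn : rank = n.-1 by rewrite WA.
  case: (@letters_finite_A R (fun k => T k.+1) n.-1) => [k kn|k kn|k l ln kl|U [mU fU TU]].
  + by apply/pmE/T_sq; lia.
  + by apply/pmE/esym/T_braid; lia.
  + apply/pmN; have -> := @T_far k.+1 l.+1; rewrite ?opprK //; lia.
  exists U; split=> // -[|k] //; rewrite rn => /andP[_ kn]; exact: TU.
Qed.

End SpinFinite.

Lemma weyl_match_ind (S : Type) (P : S -> Prop) w a b d : P a -> P b -> P d ->
  P (match w with TypeA => a | TypeB => b | TypeD => d end).
Proof. by case: w. Qed.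

(** The correction in the normal form argument contains no [x] and no [eta], which is
    why exchanging the two lowers the number of [eta]'s.  Here [T] numbers the
    letters [tau] from 1 and is 0 at a number that is not a letter. *)
Section CommutatorSpan.
Variables (W : weyl_type) (n : nat) (R : pzRingType) (Z : R -> Prop).
Hypothesis hZ : central_subring Z.
Variables (K : eqType) (rK : seq K) (rI : seq 'I_n).
Variables (x eta c : 'I_n -> R) (tau : K -> R) (T : nat -> R) (t u v : R).
Hypotheses (rI_full : forall i, i \in rI) (rK_full : forall k, k \in rK).
Hypothesis T_tau : forall k, T k = 0 \/ exists o, T k = tau o.
Local Notation PC := (words (letters rI c)).
Local Notation PT := (words (letters rK tau)).
Local Notation CT := (zspan Z (mul_set PC PT)).
Local Notation cross := (cross_elt c (bracket T) (bar_bracket W T)).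

Lemma CT_T b : PT b -> CT b.
Proof.
move=> Pb; apply: (zspan_mem hZ); exists 1, b; split; rewrite ?mul1r //.
exact: words1.
Qed.

Lemma CT_word w : CT (word_elt T w).
Proof.
have [->|/CT_T //] : word_elt T w = 0 \/ PT (word_elt T w); last by constructor.
rewrite /word_elt; elim: w => [|k w IH]; first by rewrite big_nil; right; exact: words1.
rewrite big_cons; case: IH => [->|Pw]; first by rewrite mulr0; left.
have [->|[o ->]] := T_tau k; first by rewrite mul0r; left.
by right; apply: wordsM Pw; apply: words_gen; exists o.
Qed.

Lemma central_sign m : Z ((-1) ^+ m).
Proof.
elim: m => [|m IH]; first by rewrite expr0; apply: central1 hZ.
by rewrite exprS mulN1r; apply: centralN hZ _ IH.
Qed.

Lemma CT_sign m a : CT a -> CT ((-1) ^+ m * a).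
Proof. exact/(zspanZ hZ)/central_sign. Qed.

Lemma CT_c i a : CT a -> CT (c i * a).
Proof.
apply: (zspan_mull hZ) => _ [p [q [Pp Pq ->]]].
apply: (zspan_mem hZ); exists (c i * p), q; split; rewrite ?mulrA //.
by apply: wordsM Pp; apply: words_gen; exists i.
Qed.

Lemma CT_bracket (i j : 'I_n) : CT (bracket T i j).
Proof.
rewrite /bracket; case: ifP => _; last apply: (zspanN hZ); exact/CT_sign/CT_word.
Qed.

Lemma CT_bar_bracket (i j : 'I_n) : CT (bar_bracket W T i j).
Proof.
rewrite /bar_bracket; case: ifP => _.
  by apply: weyl_match_ind; [constructor | exact/CT_sign/CT_word | exact/CT_sign/CT_word].
by apply: weyl_match_ind; [constructor | exact/CT_sign/CT_word | exact/CT_sign/CT_word].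
Qed.

Lemma CT_sgl_bracket (i : 'I_n) : CT (sgl_bracket W T i).
Proof.
by rewrite /sgl_bracket; apply: weyl_match_ind; [constructor | exact/CT_sign/CT_word | constructor].
Qed.

Lemma CT_cross i j : CT (cross i j).
Proof.
rewrite /cross_elt mulrDl mulrBl !mul1r -!mulrA.
apply: zspanD; first by apply: zspanD; [|do 2!apply: CT_c]; exact: CT_bracket.
apply: (zspanN hZ); apply: zspanD; first exact: CT_bar_bracket.
by apply: (zspanN hZ); do 2!apply: CT_c; exact: CT_bar_bracket.
Qed.

Hypotheses (Zt : Z t) (Zu : Z u) (Zv : Z v).
Hypothesis ex : forall i j, i != j -> eta i * x j - x j * eta i = u * cross i j.
Hypothesis exx : forall i, eta i * x i - x i * eta i =
  t * c i + u * (\sum_(k | k != i) cross k i) + v * sgl_bracket W T i.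

Lemma CT_commutator i j : CT (eta i * x j - x j * eta i).
Proof.
have [<-|/ex->] := eqVneq i j; last exact: (zspanZ hZ) (CT_cross _ _).
rewrite exx; apply: zspanD; last exact: (zspanZ hZ) (CT_sgl_bracket _).
apply: zspanD; apply: (zspanZ hZ) => //.
  by rewrite -[c i]mulr1; apply/CT_c/CT_T/words1.
elim/big_rec: _ => [|k a _ Ca]; first by constructor.
by apply: zspanD Ca; exact: CT_cross.
Qed.

End CommutatorSpan.

Lemma signed_elt_pm (R : pzRingType) n (g : 'I_n -> R) p : pm (signed_elt g p) (g p.1).
Proof. by rewrite /signed_elt; case: p.2; [right | left]. Qed.

Lemma pm_signed_move (R : pzRingType) n (g : 'I_n -> R) (a : R) b p :
  pm (a * b) (signed_elt g p * a) -> exists j, pm (a * b) (g j * a).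
Proof. by move=> e; exists p.1; rewrite e signed_elt_pm. Qed.

(** * The presented algebra *)

Section Hecke.
Variables (F : fieldType) (W : weyl_type) (n : nat) (t u v : F).
Local Notation H := (Hmc W n t u v).
Local Notation A := (free_alg F (hgen W n)).
Local Notation pi := (pres_pi (hrel (W := W) (n := n) t u v)).

Lemma scaleHAl k (a b : H) : k *: (a * b) = (k *: a) * b.
Proof. exact: pres_scaleAl. Qed.

Lemma scaleHAr k (a b : H) : k *: (a * b) = a * (k *: b).
Proof. exact: pres_scaleAr. Qed.

Lemma scaleH1l k (a : H) : k *: a = (k *: (1 : H)) * a.
Proof. by rewrite -scaleHAl mul1r. Qed.

Lemma scaleH1C k (a : H) : (k *: (1 : H)) * a = a * (k *: (1 : H)).
Proof. by rewrite -scaleHAl -scaleHAr mul1r mulr1. Qed.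

Lemma piD a b : pi (a + b) = pi a + pi b :> H. Proof. exact: pres_piD. Qed.
Lemma piM a b : pi (a * b) = pi a * pi b :> H. Proof. exact: pres_piM. Qed.
Lemma piZ k a : pi (k *: a) = k *: (pi a : H). Proof. exact: pres_piZ. Qed.
Lemma pi1 : pi 1 = 1 :> H. Proof. exact: pres_pi1. Qed.
Lemma pi0 : pi 0 = 0 :> H. Proof. by []. Qed.
Lemma piN a : pi (- a) = - pi a :> H.
Proof. by rewrite -scaleN1r piZ scaleN1r. Qed.
Lemma piB a b : pi (a - b) = pi a - pi b :> H.
Proof. by rewrite piD piN. Qed.
Lemma pi_sign m a : pi ((-1) ^+ m * a) = (-1) ^+ m * pi a :> H.
Proof.
elim: m => [|m IH]; first by rewrite !expr0 !mul1r.
by rewrite !exprS !mulN1r !mulNr piN IH.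
Qed.

Lemma pi_sum I (r : seq I) P (f : I -> A) :
  pi (\sum_(i <- r | P i) f i) = \sum_(i <- r | P i) (pi (f i) : H).
Proof.
by elim/big_rec2: _ => [|i a b _ <-]; rewrite ?pi0 ?piD.
Qed.

Lemma pi_prod I (r : seq I) (f : I -> A) :
  pi (\prod_(i <- r) f i) = \prod_(i <- r) (pi (f i) : H).
Proof.
by elim/big_rec2: _ => [|i a b _ <-]; rewrite ?pi1 ?piM.
Qed.

Definition Hgen (g : hgen W n) : H := pi (free_gen F g).

(** Lifting to the free algebra, an element is a combination of words, and a word
    grows by one letter on the right. *)
Lemma Hgen_ind (P : H -> Prop) :
  P 1 -> (forall a b, P a -> P b -> P (a + b)) -> (forall k a, P a -> P (k *: a)) ->
  (forall a g, P a -> P (a * Hgen g)) -> forall h, P h.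
Proof.
move=> P1 PD PZ PM h; rewrite -(pres_reprK h); set a := pres_repr h.
have P0 : P 0 by rewrite -(scale0r (1 : H)); exact: PZ.
rewrite [a]monalg.monalgE pi_sum; elim/big_rec: _ => // w b _ Pb; apply: PD => //.
have -> : monalg.mkmalgU w (monalg.mcoeff w a) = monalg.mcoeff w a *: monalg.mkmalgU w 1 :> A.
  by rewrite -[in RHS]monalg.mul_malgC monalg.malgM_def monalg.fgmulUU mulr1 monalg.mul1m.
rewrite piZ; apply: PZ; case: w => w.
elim/last_ind: w => [|w g IH].
  by have -> : monalg.mkmalgU (monalg.FMonom [::]) 1 = 1 :> A; rewrite -?monalg.fmoneE.
have -> : monalg.mkmalgU (monalg.FMonom (rcons w g)) 1 = monalg.mkmalgU (monalg.FMonom w) 1 * free_gen F g :> A.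
  rewrite monalg.malgM_def monalg.fgmulUU mulr1; congr monalg.mkmalgU.
  by rewrite /monalg.mmul /= monalg.fmmulE monalg.fmuE -cats1.
by rewrite piM; apply: PM.
Qed.

Lemma Heven1 : Heven (1 : H).
Proof.
exists 1; last exact: pi1.
move=> w; rewrite monalg.mcoeff1; case: (w =P _) => [->|_]; last by rewrite eqxx.
by rewrite monalg.fm1.
Qed.

Lemma HevenD (a b : H) : Heven a -> Heven b -> Heven (a + b).
Proof.
move=> [a' ea <-] [b' eb <-]; exists (a' + b'); last exact: piD.
move=> w; rewrite monalg.mcoeffD => h.
case: (eqVneq (monalg.mcoeff w a') 0) => [a0|]; last exact: ea.
by apply: eb; move: h; rewrite a0 add0r.
Qed.

Lemma HevenZ k (a : H) : Heven a -> Heven (k *: a).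
Proof.
move=> [a' ea <-]; exists (k *: a'); last exact: piZ.
by move=> w; rewrite monalg.mcoeffZ mulf_eq0 negb_or => /andP[_]; exact: ea.
Qed.

Lemma HevenM (a b : H) : Heven a -> Heven b -> Heven (a * b).
Proof.
move=> [a' ea <-] [b' eb <-]; exists (a' * b'); last exact: piM.
move=> w; rewrite monalg.mcoeff_neq0 => /monalg.msuppM_le[w1 [w2 [+ + ->]]].
rewrite -!monalg.mcoeff_neq0 => /ea e1 /eb e2.
rewrite /even_word monalg.fmM count_cat oddD.
by move: e1 e2; rewrite /even_word; do 2!case: (odd _).
Qed.

Lemma Heven_gen g : ~~ odd_gen g -> Heven (Hgen g).
Proof.
move=> og; exists (free_gen F g) => // w; rewrite monalg.mcoeffU.
case: (_ =P w) => [<- _|_]; last by rewrite eqxx.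
by rewrite /even_word monalg.fmU /= addn0; case: (odd_gen g) og.
Qed.

Lemma Heven_gen2 g h : odd_gen g -> odd_gen h -> Heven (Hgen g * Hgen h).
Proof.
move=> og oh; exists (free_gen F g * free_gen F h); last exact: piM.
move=> w; rewrite monalg.malgM_def monalg.fgmulUU monalg.mcoeffU mulr1.
case: (_ =P w) => [<- _|_]; last by rewrite eqxx.
by rewrite /even_word monalg.fmM !monalg.fmU /= og oh.
Qed.


(** A common range of monomials for all polynomials of bounded size makes the
    evaluation visibly linear. *)
Lemma HevalE d (a : 'I_n -> H) (p : {mpoly F[n]}) : (msize p <= d)%N ->
  Heval a p = \sum_(m : 'X_{1..n < d}) p@_m *: \prod_i a i ^+ m i.
Proof.
move=> le_pd; set I : subFinType _ := 'X_{1..n < d}.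
rewrite /Heval (big_mksub I) ?msupp_uniq //=; first last.
  by move=> m /msize_mdeg_lt /leq_trans; apply.
by rewrite big_rmcond //= => j /memN_msupp_eq0 ->; rewrite scale0r.
Qed.

Lemma HevalZD (a : 'I_n -> H) k p q :
  Heval a (k *: p + q) = k *: Heval a p + Heval a q.
Proof.
set d := maxn (msize (k *: p + q)) (maxn (msize p) (msize q)).
rewrite !(@HevalE d) ?leq_max ?leqnn ?orbT //.
rewrite scaler_sumr -big_split; apply: eq_bigr => m _ /=.
by rewrite mcoeffD mcoeffZ scalerDl scalerA.
Qed.

Lemma Heval0 (a : 'I_n -> H) : Heval a 0 = 0.
Proof. by rewrite (@HevalE 0) ?msize0 // big1 // => m _; rewrite mcoeff0 scale0r. Qed.

Lemma HevalD (a : 'I_n -> H) p q : Heval a (p + q) = Heval a p + Heval a q.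
Proof. by rewrite -[p in LHS]scale1r HevalZD scale1r. Qed.

Lemma HevalZ (a : 'I_n -> H) k p : Heval a (k *: p) = k *: Heval a p.
Proof. by rewrite -[_ *: p]addr0 HevalZD Heval0 addr0. Qed.

Lemma HevalX (a : 'I_n -> H) m : Heval a 'X_[m] = \prod_i a i ^+ m i.
Proof. by rewrite /Heval msuppX big_seq1 mcoeffX eqxx scale1r. Qed.

Lemma Heval1 (a : 'I_n -> H) : Heval a 1 = 1.
Proof. by rewrite -mpolyX0 HevalX big1 // => i _; rewrite mnm0E. Qed.

Lemma Heval_var (a : 'I_n -> H) k : Heval a 'X_k = a k.
Proof.
rewrite HevalX -[RHS](big_pred1_eq *%R k a) big_mkcond /=.
by apply: eq_bigr => i _; rewrite mnm1E eq_sym; case: eqP => [->|].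
Qed.

Section Commuting.
Variable a : 'I_n -> H.
Hypothesis comm_a : forall i j, a i * a j = a j * a i.

Lemma comm_exp i j d e : GRing.comm (a i ^+ d) (a j ^+ e).
Proof. by apply/commrX/commr_sym/commrX/comm_a. Qed.

Lemma HevalXX m m' : Heval a ('X_[m] * 'X_[m']) = Heval a 'X_[m] * Heval a 'X_[m'].
Proof.
rewrite -mpolyXD !HevalX -prodrM_comm; last by move=> *; apply: comm_exp.
by apply: eq_bigr => i _; rewrite mnmDE exprD.
Qed.

Lemma HevalM p q : Heval a (p * q) = Heval a p * Heval a q.
Proof.
elim/mpolyind: p => [|k m p _ _ IHp]; first by rewrite mul0r Heval0 mul0r.
rewrite mulrDl HevalD IHp HevalZD mulrDl; congr (_ + _).
elim/mpolyind: q {IHp} => [|l m' q _ _ IHq]; first by rewrite mulr0 Heval0 mulr0.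
rewrite mulrDr HevalD IHq HevalZD mulrDr; congr (_ + _).
have -> : (k *: 'X_[m]) * (l *: 'X_[m']) = k *: (l *: ('X_[m] * 'X_[m'])) :> {mpoly F[n]}.
  by rewrite -scalerAl -scalerAr.
by rewrite !HevalZ HevalXX -scaleHAl -scaleHAr.
Qed.

End Commuting.

End Hecke.

Lemma weyl_match (S T : Type) (f : S -> T) w a b d :
  f (match w with TypeA => a | TypeB => b | TypeD => d end) =
  match w with TypeA => f a | TypeB => f b | TypeD => f d end.
Proof. by case: w. Qed.

Lemma weyl_match_eq (T : Type) w (a b d a' b' d' : T) : a = a' -> b = b' -> d = d' ->
  match w with TypeA => a | TypeB => b | TypeD => d end =
  match w with TypeA => a' | TypeB => b' | TypeD => d' end.
Proof. by move=> -> -> ->. Qed.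

Lemma weyl_matchA (T : Type) w (a b : T) : w = TypeA ->
  match w with TypeA => a | _ => b end = a.
Proof. by move=> ->. Qed.

Lemma weyl_matchBD (T : Type) w (a b : T) : w <> TypeA ->
  match w with TypeA => a | _ => b end = b.
Proof. by case: w. Qed.

Lemma bar_bracketA (R : pzRingType) n W (T : nat -> R) (i j : 'I_n) :
  W = TypeA -> bar_bracket W T i j = 0.
Proof. by move=> ->; rewrite /bar_bracket; case: ifP. Qed.

Section HeckeRelations.
Variables (F : fieldType) (W : weyl_type) (n : nat) (t u v : F).
Local Notation H := (Hmc W n t u v).
Local Notation A := (free_alg F (hgen W n)).
Local Notation pi := (pres_pi (hrel (W := W) (n := n) t u v)).
Definition xH (i : 'I_n) : H := Hgen t u v (GenX W i).
Definition etaH (i : 'I_n) : H := Hgen t u v (GenEta W i).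
Definition cH (i : 'I_n) : H := Hgen t u v (GenC W i).
Definition tH (k : 'I_(weyl_rank W n)) : H := Hgen t u v (GenT k).
Definition TH (k : nat) : H := pi (tgen F W n k).
Local Notation sc k := (k *: (1 : H)).

Lemma pi_rel a b : hrel t u v a b -> pi a = pi b :> H.
Proof. exact: pres_rel. Qed.

Lemma pi_sgn_act (g : 'I_n -> A) s j :
  pi (sgn_act g s j) = signed_elt (fun i => pi (g i) : H) (s (j, false)) :> H.
Proof. by rewrite /sgn_act /signed_elt /flips /star; case: ifP => _; rewrite ?piN. Qed.

Lemma THE (o : 'I_(weyl_rank W n)) : TH o.+1 = tH o.
Proof. by rewrite /TH /= valK. Qed.

Lemma TH_out k : (forall o : 'I_(weyl_rank W n), k <> o.+1) -> TH k = 0.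
Proof.
case: k => [|k] ko; rewrite /TH //=; case: insubP => [o _ e|] //=.
by case: (ko o); rewrite e.
Qed.

(** A number that is not a letter stands for 0 in the algebra and for the identity in
    the group; the exchange rules below then hold for all numbers. *)
Lemma TH_cases k : TH k = 0 \/ exists o : 'I_(weyl_rank W n), k = o.+1.
Proof.
case: (boolP [exists o : 'I_(weyl_rank W n), k == o.+1]) => [/existsP[o /eqP]|/existsPn h].
  by right; exists o.
by left; apply: TH_out => o e; have := h o; rewrite e eqxx.
Qed.

Lemma pi_tword w : pi (tword F W n w) = word_elt TH w.
Proof. by rewrite /tword pi_prod. Qed.

Lemma pi_brk i j : pi (brk F W i j) = bracket TH i j.
Proof.
by rewrite /brk /bracket; case: ifP => _; rewrite ?piN /brk_lt pi_sign pi_tword.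
Qed.

Lemma pi_brk_bar i j : pi (brk_bar F W i j) = bar_bracket W TH i j.
Proof.
rewrite /brk_bar /bar_bracket /brk_bar_lt.
by case: ifP => _; rewrite (weyl_match pi);
  (apply: weyl_match_eq; [exact: pi0 | rewrite pi_sign pi_tword | rewrite pi_sign pi_tword]).
Qed.

Lemma pi_brk_sgl i : pi (if W is TypeB then v *: brk_sgl F W i else 0) =
  sc v * sgl_bracket W TH i.
Proof.
rewrite (weyl_match pi) piZ /brk_sgl pi_sign pi_tword.
apply: (etrans _ (esym (weyl_match (fun h : H => sc v * h) W 0 _ 0))).
by rewrite mulr0 scaleH1l.
Qed.

Lemma pi_cross i j : pi (cross F W i j) = cross_elt cH (bracket TH) (bar_bracket W TH) i j.
Proof.
have e : pi ((1 + free_gen F (GenC W i) * free_gen F (GenC W j)) * brk F W i j) =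
    (1 + cH i * cH j) * bracket TH i j.
  move: (pi_brk i j); move: (brk _ _ _ _) => b <-.
  rewrite piM piD pi1 piM; reflexivity.
have e' : pi ((1 - free_gen F (GenC W i) * free_gen F (GenC W j)) * brk_bar F W i j) =
    (1 - cH i * cH j) * bar_bracket W TH i j.
  move: (pi_brk_bar i j); move: (brk_bar _ _ _ _) => b <-.
  rewrite piM piB pi1 piM; reflexivity.
rewrite /cross; have [WA|WA] : W = TypeA \/ W <> TypeA by case: (W); [left|right|right].
  rewrite (weyl_matchA _ _ WA) e; apply/esym/cross_elt_rb0.
  exact: bar_bracketA.
rewrite (weyl_matchBD _ _ WA) piB.
exact: (congr2 (fun a b : H => a - b) e e').
Qed.

Lemma cH_sq i : cH i * cH i = 1.
Proof. by rewrite -piM (pi_rel (Rel_cc W t u v i)). Qed.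

Lemma cH_anti i j : i != j -> cH i * cH j = - (cH j * cH i).
Proof. by move=> ij; rewrite -piM (pi_rel (Rel_cicj W t u v ij)) piN piM. Qed.

Lemma etaH_anti i j : i != j -> etaH i * etaH j = - (etaH j * etaH i).
Proof. by move=> ij; rewrite -piM (pi_rel (Rel_etaeta W t u v ij)) piN piM. Qed.

Lemma xH_comm i j : xH i * xH j = xH j * xH i.
Proof.
have [->//|ij] := eqVneq i j.
by rewrite -piM (pi_rel (Rel_xx W t u v ij)) piM.
Qed.

Lemma cH_eta i j : cH i * etaH j = - (etaH j * cH i).
Proof. by rewrite -piM (pi_rel (Rel_ceta W t u v i j)) piN piM. Qed.

Lemma cH_x i j : cH i * xH j = (-1) ^+ (i == j) * (xH j * cH i).
Proof. by rewrite -piM (pi_rel (Rel_cx W t u v i j)) pi_sign piM. Qed.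

Lemma pi_comm a b : pi (comm a b) = (pi a : H) * (pi b : H) - (pi b : H) * (pi a : H).
Proof. by rewrite /comm (piB t u v (a * b)) (piM t u v a b) (piM t u v b a). Qed.

Lemma pi_lin k l a b d : pi (k *: a + l *: b + d) = sc k * (pi a : H) + sc l * (pi b : H) + (pi d : H).
Proof.
rewrite (piD t u v (k *: a + l *: b) d) (piD t u v (k *: a) (l *: b)) (piZ t u v k a) (piZ t u v l b).
rewrite (scaleH1l k (pi a : H)) (scaleH1l l (pi b : H)); reflexivity.
Qed.

Lemma etaH_x i j : i != j -> etaH i * xH j - xH j * etaH i =
  sc u * cross_elt cH (bracket TH) (bar_bracket W TH) i j.
Proof.
move=> ij; have := pi_rel (Rel_etax_ne W t u v ij).
rewrite pi_comm (piZ t u v u (cross F W i j)) pi_cross.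
by move: (cross_elt _ _ _ _ _) => h; rewrite scaleH1l.
Qed.

Lemma etaH_xx i : etaH i * xH i - xH i * etaH i =
  sc t * cH i + sc u * (\sum_(k | k != i) cross_elt cH (bracket TH) (bar_bracket W TH) k i)
  + sc v * sgl_bracket W TH i.
Proof.
have := pi_rel (Rel_etax W t u v i).
rewrite pi_comm pi_lin pi_brk_sgl pi_sum => e; apply: (etrans e).
rewrite (eq_bigr _ (fun k _ => pi_cross k i)); reflexivity.
Qed.

Hypothesis hn : admissible W n.

Lemma simple_flip (o : 'I_(weyl_rank W n)) j :
  simple_refl o (j, true) = ((simple_refl o (j, false)).1, ~~ (simple_refl o (j, false)).2).
Proof. exact: simple_refl_signed hn o (j, false). Qed.

Lemma signed_eltN (R : pzRingType) (g : 'I_n -> R) p : signed_elt g (p.1, ~~ p.2) = - signed_elt g p.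
Proof. by rewrite /signed_elt /=; case: p.2 => //=; rewrite opprK. Qed.

Lemma tH_x o j : tH o * xH j = signed_elt xH (simple_refl o (j, false)) * tH o.
Proof. by rewrite -piM (pi_rel (Rel_tx t u v o j)) piM pi_sgn_act. Qed.

Lemma tH_c o j : tH o * cH j = - (signed_elt cH (simple_refl o (j, false)) * tH o).
Proof. by rewrite -piM (pi_rel (Rel_tc t u v o j)) piN piM pi_sgn_act. Qed.

Lemma tH_eta o j : tH o * etaH j = - (etaH (star (simple_refl o) j) * tH o).
Proof. by rewrite -piM (pi_rel (Rel_teta t u v o j)) piN piM. Qed.

Lemma TH_x (k : nat) p : TH k * signed_elt xH p = signed_elt xH (letter_perm W n k p) * TH k.
Proof.
have [->|[o ->]] := TH_cases k; first by rewrite mul0r mulr0.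
rewrite THE letter_permE; case: p => j [|]; last exact: tH_x.
rewrite simple_flip -[(j, true)]/((j, false).1, ~~ (j, false).2) !signed_eltN.
by rewrite mulrN mulNr tH_x.
Qed.

Lemma TH_eta (k : nat) j : TH k * etaH j = - (etaH (letter_perm W n k (j, false)).1 * TH k).
Proof.
have [->|[o ->]] := TH_cases k; first by rewrite mul0r mulr0 oppr0.
by rewrite THE letter_permE tH_eta.
Qed.

Lemma pi_exp a m : pi (a ^+ m) = (pi a : H) ^+ m.
Proof. by elim: m => [|m IH]; rewrite ?expr0 ?pi1 // !exprS piM IH. Qed.

Lemma TH_rel k l : (0 < k <= weyl_rank W n)%N -> (0 < l <= weyl_rank W n)%N ->
  let m := #[letter_perm W n k * letter_perm W n l]%g in
  (TH k * TH l) ^+ m = (-1) ^+ m.+1.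
Proof.
case: k => [|k] // kr; case: l => [|l] // lr.
rewrite -[k.+1]/((Ordinal kr : nat).+1) -[l.+1]/((Ordinal lr : nat).+1).
rewrite !letter_permE !THE => m; rewrite -piM -pi_exp.
rewrite (pi_rel (Rel_t t u v (Ordinal kr) (Ordinal lr))).
by rewrite pi_exp piN pi1.
Qed.

End HeckeRelations.

Section EvenCenter.
Variables (F : fieldType) (W : weyl_type) (n : nat) (t u v : F).
Hypothesis hn : admissible W n.
Local Notation H := (Hmc W n t u v).
Local Notation sc k := (k *: (1 : H)).
Local Notation x := (xH W (n := n) t u v).
Local Notation eta := (etaH W (n := n) t u v).
Local Notation c := (cH W (n := n) t u v).
Local Notation T := (tH (W := W) (n := n) t u v).
Local Notation TT := (TH W n t u v).
Local Notation rename s := (comp_mpoly [tuple 'X_(s i) | i < n]).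

Let scHC k (h : H) : sc k * h = h * sc k := scaleH1C k h.

(** The generators and the scalars span under products, so centrality need only be
    tested on the generators. *)
Lemma even_center_gen (z : H) : Heven z -> (forall i, z * x i = x i * z) ->
  (forall i, z * eta i = eta i * z) -> (forall i, z * c i = c i * z) ->
  (forall k, z * T k = T k * z) -> even_center z.
Proof.
move=> ez zx ze zc zt; split; first exact: ez.
apply: Hgen_ind => [|a b|k a|a g].
- exact: commr1.
- exact: commrD.
- by move=> ea; rewrite -scaleHAl -scaleHAr ea.
move=> za; apply: commrM za _.
by case: g => i; [exact: zx | exact: ze | exact: zc | exact: zt].
Qed.

Lemma even_centerM (z z' : H) : even_center z -> even_center z' -> even_center (z * z').
Proof.
move=> [ez cz] [ez' cz']; split=> [|h]; first by exact: HevenM.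
by rewrite -mulrA cz' mulrA cz mulrA.
Qed.

Lemma even_centerD (z z' : H) : even_center z -> even_center z' -> even_center (z + z').
Proof.
move=> [ez cz] [ez' cz']; split=> [|h]; first by exact: HevenD.
by rewrite mulrDl mulrDr cz cz'.
Qed.

Lemma even_centerZ k (z : H) : even_center z -> even_center (k *: z).
Proof.
move=> [ez cz]; split=> [|h]; first by exact: HevenZ.
by rewrite -scaleHAl -scaleHAr cz.
Qed.

Lemma even_center1 : even_center (1 : H).
Proof. by split=> [|h]; [exact: Heven1 | rewrite mul1r mulr1]. Qed.

Lemma even_center0 : even_center (0 : H).
Proof. by rewrite -(scale0r (1 : H)); apply/even_centerZ/even_center1. Qed.

Lemma even_centerN (z : H) : even_center z -> even_center (- z).
Proof. by move=> cz; rewrite -scaleN1r; apply: even_centerZ. Qed.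

Lemma even_centerC (z h : H) : even_center z -> z * h = h * z.
Proof. by case=> _. Qed.

Lemma Heven_eval (a : 'I_n -> H) p : (forall i, Heven (a i)) -> Heven (Heval a p).
Proof.
move=> ea; rewrite /Heval.
elim/big_rec: _ => [|m h _ eh]; first by case: even_center0.
apply: HevenD eh; apply: HevenZ; elim/big_rec: _ => [|i b _ eb]; first exact: Heven1.
apply: HevenM eb; elim: (m i) => [|d IH]; first by rewrite expr0; exact: Heven1.
by rewrite exprS; apply: HevenM.
Qed.

Section Twist.
Variable a : 'I_n -> H.
Hypothesis comm_a : forall i j, a i * a j = a j * a i.

Lemma HevalZ1 k (p : {mpoly F[n]}) : Heval a (k *: p) = sc k * Heval a p.
Proof. exact: etrans (HevalZ a k p) (scaleH1l _ _). Qed.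

Lemma Heval_twist (s : 'I_n -> 'I_n) (r : H) p : (forall i, r * a i = a (s i) * r) ->
  r * Heval a p = Heval a (rename s p) * r.
Proof.
move=> ra.
exact: (ev_twist scHC (Heval1 a) (HevalD a) HevalZ1 (HevalM comm_a) (Heval_var a) p ra).
Qed.

Lemma Heval_comm (r : H) p : (forall i, r * a i = a i * r) -> r * Heval a p = Heval a p * r.
Proof. by move=> ra; rewrite (Heval_twist (s := id)) ?rename_id. Qed.

Lemma Heval_sym (i : 'I_n) (h : H) (E : 'I_n -> H) p :
  weyl_invariant W p ->
  (forall j k, j != i -> E j * a k = a (tperm i j k) * E j) ->
  (forall j, j != i -> h * a j - a j * h = E j) ->
  h * a i - a i * h = - (\sum_(j | j != i) E j) ->
  h * Heval a p = Heval a p * h.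
Proof.
move=> inv_p aE hE hi.
apply: (ev_sym_comm scHC (Heval1 a) (HevalD a) HevalZ1 (HevalM comm_a)
  (Heval_var a) aE hE hi) => j.
exact: weyl_invariant_tperm inv_p.
Qed.

End Twist.

Let rx := bracket_x hn (@TH_x _ W n t u v hn).
Let re := bracket_eta hn (@TH_eta _ W n t u v).
Let bx := bar_bracket_x hn (@TH_x _ W n t u v hn).
Let be := bar_bracket_eta hn (@TH_eta _ W n t u v).
Let sx := sgl_bracket_x hn (@TH_x _ W n t u v hn).
Let se := sgl_bracket_eta hn (@TH_eta _ W n t u v).

Let x2_comm := x2_x2 (xH_comm W (n := n) t u v).
Let eta2_comm := eta2_eta2 (@etaH_anti _ W n t u v).

Lemma signed_sq (g : 'I_n -> H) p (s : H) : s = signed_elt g p -> s ^+ 2 = g p.1 ^+ 2.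
Proof. by move=> ->; rewrite /signed_elt; case: p.2; rewrite ?sqrrN. Qed.

Local Notation K := (cross_elt c (bracket TT) (bar_bracket W TT)).

Lemma eta_Heval_x2 p i : weyl_invariant W p ->
  eta i * Heval (fun k => x k ^+ 2) p = Heval (fun k => x k ^+ 2) p * eta i.
Proof.
move=> inv_p.
have twist j k : j != i -> sc u * (K i j * x j + x j * K i j) * x k ^+ 2 =
    x (tperm i j k) ^+ 2 * (sc u * (K i j * x j + x j * K i j)).
  rewrite eq_sym => ij.
  exact: (eta_x2_twist (scHC u) (xH_comm W t u v) (cH_x W t u v) rx bx k ij).
have off j : j != i -> eta i * x j ^+ 2 - x j ^+ 2 * eta i =
    sc u * (K i j * x j + x j * K i j).
  by rewrite eq_sym; exact: (eta_x2_comm (scHC u) (@etaH_x _ W n t u v)).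
have diag := eta_x2_diag (scHC t) (scHC u) (scHC v) (@cH_anti _ W n t u v)
  (cH_x W t u v) rx bx (@bracketN _ _ TT) (@bar_bracketC W _ _ TT) sx (etaH_xx W t u v) i.
exact: (Heval_sym x2_comm inv_p twist off diag).
Qed.

Lemma x_Heval_eta2 p j : weyl_invariant W p ->
  x j * Heval (fun k => eta k ^+ 2) p = Heval (fun k => eta k ^+ 2) p * x j.
Proof.
move=> inv_p.
have twist i k : i != j -> - (sc u * (eta i * K i j + K i j * eta i)) * eta k ^+ 2 =
    eta (tperm j i k) ^+ 2 * - (sc u * (eta i * K i j + K i j * eta i)).
  rewrite tpermC.
  exact: (x_eta2_twist (scHC u) (@etaH_anti _ W n t u v) (cH_eta W t u v) re be).
have off i : i != j -> x j * eta i ^+ 2 - eta i ^+ 2 * x j =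
    - (sc u * (eta i * K i j + K i j * eta i)).
  exact: (x_eta2_comm (scHC u) (@etaH_x _ W n t u v)).
have diag := x_eta2_diag (scHC t) (scHC u) (scHC v) (cH_eta W t u v) re be se
  (etaH_xx W t u v) j.
exact: (Heval_sym eta2_comm inv_p twist off diag).
Qed.

Theorem even_center_x p : weyl_invariant W p ->
  even_center (Heval (fun i => x i ^+ 2) p).
Proof.
move=> inv_p; apply: even_center_gen => [|i|i|i|k].
- apply: Heven_eval => i; rewrite expr2.
  by apply: HevenM; apply: Heven_gen.
- by apply/esym/(Heval_comm x2_comm) => j; apply/commrX/xH_comm.
- exact/esym/eta_Heval_x2.
- by apply/esym/(Heval_comm x2_comm) => j; exact: (c_x2 (cH_x W t u v)).
have tx i : T k * x i ^+ 2 = x (star (simple_refl k) i) ^+ 2 * T k.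
  rewrite -(signed_sq (erefl (signed_elt x (simple_refl k (i, false))))).
  by apply: (@sqr_move _ _ _ _ 0); rewrite expr0 mul1r; exact: tH_x.
have := Heval_twist x2_comm p tx.
rewrite (weyl_invariant_letter k hn inv_p); exact: esym.
Qed.

Theorem even_center_eta p : weyl_invariant W p ->
  even_center (Heval (fun i => eta i ^+ 2) p).
Proof.
move=> inv_p; apply: even_center_gen => [|i|i|i|k].
- by apply: Heven_eval => i; rewrite expr2; apply: Heven_gen2.
- exact/esym/x_Heval_eta2.
- by apply/esym/(Heval_comm eta2_comm) => j; exact: (eta_eta2 (@etaH_anti _ W n t u v)).
- by apply/esym/(Heval_comm eta2_comm) => j; exact: (c_eta2 (cH_eta W t u v)).
have te i : T k * eta i ^+ 2 = eta (star (simple_refl k) i) ^+ 2 * T k.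
  by apply: sqr_moveN; apply: tH_eta.
have := Heval_twist eta2_comm p te.
rewrite (weyl_invariant_letter k hn inv_p); exact: esym.
Qed.

Local Notation Z := (@even_center F W n t u v).

Lemma even_center_sc k : Z (sc k).
Proof. exact/even_centerZ/even_center1. Qed.

Lemma even_center_central : central_subring Z.
Proof.
split; [exact: even_center1 | exact: even_centerD | exact: even_centerN |
  exact: even_centerM | exact: even_centerC].
Qed.
Let hZ := even_center_central.

(** [g i ^ 2] is a root of a monic polynomial of degree [n] whose coefficients are
    symmetric in the squares, hence even and central; this bounds the exponent of
    [g i] by [2 * n]. *)
Lemma zfinite_root_powers (g : 'I_n -> H) i :
  (forall j k, g j ^+ 2 * g k ^+ 2 = g k ^+ 2 * g j ^+ 2) ->
  (forall p, weyl_invariant W p -> Z (Heval (fun k => g k ^+ 2) p)) ->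
  zfinite Z (powers (g i)).
Proof.
move=> gg gZ; apply: (zfinite_powers hZ (N := 2 * n)).
rewrite exprM (ev_root (Heval1 _) (HevalD _) (HevalM gg) (Heval_var _) i).
apply: (zspanN hZ).
elim/big_rec: _ => [|k a _ Ca]; first by constructor.
apply: zspanD Ca; apply: (zspanZ hZ); first exact/gZ/weyl_invariant_root_poly.
apply: (zspan_mem hZ); apply/mapP; exists (2 * k)%N; last by rewrite exprM.
by rewrite mem_iota add0n ltn_mul2l ltn_ord.
Qed.

Let rI := enum 'I_n.
Let rK := enum 'I_(weyl_rank W n).

Lemma c_powers_finite i : zfinite Z (powers (c i)).
Proof.
apply: (zfinite_powers hZ (N := 2)); rewrite expr2 cH_sq.
by apply: (zspan_mem hZ); apply/mapP; exists 0%N.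
Qed.

Let pm_xx i j : pm (x i * x j) (x j * x i).
Proof. by left; apply: xH_comm. Qed.
Let pm_etaeta i j : pm (eta i * eta j) (eta j * eta i).
Proof. by have [->|ij] := eqVneq i j; [left | right; apply: etaH_anti]. Qed.
Let pm_cc i j : pm (c i * c j) (c j * c i).
Proof. by have [->|ij] := eqVneq i j; [left | right; apply: cH_anti]. Qed.
Let pm_ceta i j : pm (c i * eta j) (eta j * c i).
Proof. by right; apply: cH_eta. Qed.
Let pm_cx i j : pm (c i * x j) (x j * c i).
Proof.
by rewrite cH_x; case: (i == j); [right; rewrite expr1 mulN1r | left; rewrite expr0 mul1r].
Qed.
Let t_x k i : exists j, pm (T k * x i) (x j * T k).
Proof. by apply: (@pm_signed_move _ _ _ _ _ (simple_refl k (i, false))); left; apply: tH_x. Qed.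
Let t_c k i : exists j, pm (T k * c i) (c j * T k).
Proof. by apply: (@pm_signed_move _ _ _ _ _ (simple_refl k (i, false))); right; apply: tH_c. Qed.
Let t_eta k i : exists j, pm (T k * eta i) (eta j * T k).
Proof. by exists (star (simple_refl k) i); right; apply: tH_eta. Qed.

Let TT_T k : TT k = 0 \/ exists o, TT k = T o.
Proof.
have [->|[o ->]] := TH_cases W n t u v k; first by left.
by right; exists o; apply: THE.
Qed.

Lemma T_words_finite : zfinite Z (words (letters rK T)).
Proof.
have [U [mU fU TU]] := spin_words_finite hn (@TH_rel _ W n t u v).
apply: (zfinite_sub hZ) (zfinite_pm hZ fU) => a Ta; apply: (zspan_mem hZ).
apply: words_in mU _ Ta => _ [k _ ->]; rewrite -THE; apply: TU.
by rewrite /= ltn_ord.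
Qed.

Let L := zspan Z (mul_set (words (letters rI x)) (mul_set (words (letters rI eta))
  (mul_set (words (letters rI c)) (words (letters rK T))))).

Let rI_full i : i \in rI. Proof. by rewrite mem_enum. Qed.
Let rK_full k : k \in rK. Proof. by rewrite mem_enum. Qed.

Let comm_CT := CT_commutator hZ rI_full rK_full TT_T (even_center_sc t)
  (even_center_sc u) (even_center_sc v) (@etaH_x _ W n t u v) (etaH_xx W t u v).

Lemma normal_span h : L h.
Proof.
apply: Hgen_ind h => [|a b|k a|a g].
- exact: (normal_form1 hZ).
- exact: zspanD.
- by rewrite scaleH1l; apply: (zspanZ hZ); exact: even_center_sc.
case: g => i.
- exact: (normal_rmul_x hZ rI_full rK_full t_c t_x t_eta pm_cx pm_ceta comm_CT).
- exact: (normal_rmul_eta hZ rI_full t_eta pm_ceta).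
- exact: (normal_rmul_c hZ rI_full t_c).
- exact: (normal_rmul_t hZ rK_full).
Qed.

Theorem hecke_module_finite : module_finite_over_even_center W n t u v.
Proof.
have fx := zfinite_letters hZ rI pm_xx (fun i => zfinite_root_powers i x2_comm even_center_x).
have fe := zfinite_letters hZ rI pm_etaeta (fun i => zfinite_root_powers i eta2_comm even_center_eta).
have fc := zfinite_letters hZ rI pm_cc c_powers_finite.
have [gs hs] := zfinite_normal hZ fx fe fc T_words_finite.
by exists gs => h; apply: (zspan_coef hZ); apply: hs; apply: normal_span.
Qed.

End EvenCenter.

Unset Implicit Arguments.

Theorem corollary4p3 (R : realType) (W : weyl_type) (n : nat)
    (hn : admissible W n) (t u v : R[i]) :
  [/\ forall p : {mpoly R[i][n]}, weyl_invariant W p ->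
        even_center (Heval (fun i => Heta W t u v i ^+ 2) p),
      forall p : {mpoly R[i][n]}, weyl_invariant W p ->
        even_center (Heval (fun i => Hx W t u v i ^+ 2) p)
    & module_finite_over_even_center W n t u v].
Proof.
split=> [p|p|]; [exact: even_center_eta | exact: even_center_x |].
exact: hecke_module_finite.
Qed.
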